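(* Let $X\sim\mathrm{CO}(\mu;q)$ with $q(j)=\delta j^2+\beta j+\gamma$, pmf $p$ and support $S=\{\alpha,\ldots,\omega\}$, let $M=|S|-1$, and assume $\mathbb E|X|^{2n+1}<\infty$ for some $n\in\{0,1,\ldots,M\}$. For all $i=0,1,\ldots,n$ consider the random variables $X_i$ with pmfs $p_i\propto q^{[i]}p$, and define $$\mu_i=\frac{\delta i^2+\beta i+\mu}{1-2i\delta},\quad q_i(j)=\frac{q(j+i)}{1-2i\delta},\quad \delta_i=\frac{\delta}{1-2i\delta},\quad \psi(i)=\frac{q\big([-\delta i^2+(\beta+1)i+\mu]/[1-2i\delta]\big)}{1-(2i+1)\delta}.$$ (Note that $X_0=X$ and, for $i=1,\ldots,n$, the pmf of $X_i$ is proportional to $q_{i-1}p_{i-1}$.) Then: (a) $X_i$ is supported on $\{\alpha,\ldots,\omega-i\}$. (b) $X_i\sim\mathrm{CO}(\mu_i;q_i)$. (c) $\mathrm{Var}(X_i)=\psi(i)$ (for $i=n$ it is additionally required that $\mathbb E|X|^{2n+2}<\infty$). (d) $\mathbb E[q^{[i]}(X)]=\psi^{[i]}(0)\,\Pi_{2\delta}^{[i]}(0)$. (e) The descending factorial moments $\mu_{(r)}=\mathbb E[(X)_r]$ and the ascending factorial moments $\mu_{[r]}=\mathbb E\big[[X]_r\big]$ satisfy the second-order recurrence relations $$(1-r\delta)\mu_{(r+1)}=\{\mu+r[\beta-1+(2r-1)\delta]\}\mu_{(r)}+r\{\gamma+(r-1)[\beta+(r-1)\delta]\}\mu_{(r-1)},$$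 $$(1-r\delta)\mu_{[r+1]}=\{\mu+r[\beta+2-(2r-1)\delta]\}\mu_{[r]}+r\{\gamma-\mu-(r-1)[\beta+1-(r-1)\delta]\}\mu_{[r-1]},$$ with initial conditions $\mu_{(0)}=\mu_{[0]}=1$ and $\mu_{(1)}=\mu_{[1]}=\mu$, for all $r=1,\ldots,2n$. (f) The factorial moments also satisfy, for all $r=1,\ldots,2n$, the recurrence relations $$(1-r\delta)\mu_{[r+1]}=[\mu+r(\beta-r\delta+1)]\mu_{[r]}+\gamma\, r!\sum_{k=0}^{r-1}\frac{\mu_{[k]}}{k!},$$ $$(1-r\delta)\mu_{(r+1)}=(\delta r^2+\beta r+\mu)\mu_{(r)}+(\gamma-\mu)\,r!\sum_{k=0}^{r-1}(-1)^{r+k+1}\frac{\mu_{(k)}}{k!}.$$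
   Context: An integer-valued random variable $X$ with finite mean $\mu$ and pmf $p$ satisfies $X\sim\mathrm{CO}(\mu;q)$ (Cumulative Ord family), with $q(j)=\delta j^2+\beta j+\gamma$ a real polynomial of degree at most two, if $\sum_{k\le j}(\mu-k)p(k)=q(j)p(j)$ for all $j\in\mathbb Z$. Its support $\{j:p(j)>0\}$ is a set of consecutive integers $\{\alpha,\ldots,\omega\}$ ($\alpha,\omega$ possibly infinite; $\omega-i=\infty$ if $\omega=\infty$). Notation: $f^{[k]}(x)=f(x)f(x+1)\cdots f(x+k-1)$, $f^{[0]}=1$; $(z)_k=z(z-1)\cdots(z-k+1)$ and $[z]_k=z(z+1)\cdots(z+k-1)$, both equal to $1$ for $k=0$; $\Pi_{\delta}^{[k]}(m)=\prod_{j=m}^{k+m-1}(1-j\delta)$, $\Pi_\delta^{[0]}(m)=1$.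
   Formalization: In (b), (c) and (d) the denominators 1−2iδ and 1−(2i+1)δ that occur are required to be nonzero where they can vanish (|S|=i+1, resp. |S|≤i+2); e.g. masses 1/6, 4/6, 1/6 on {0,1,2} give δ=1/4 and 1−2iδ=0 at i=2=M. *)

(* Defs.v *)
(* MathComp-Analysis *)
From HB Require Import structures.
From mathcomp Require Import all_boot all_order all_algebra.
From mathcomp Require Import all_classical all_reals all_analysis.

Set Implicit Arguments.
Unset Strict Implicit.
Unset Printing Implicit Defensive.

Import Order.TTheory GRing.Theory Num.Theory.
Import numFieldNormedType.Exports.

Local Open Scope classical_set_scope.
Local Open Scope card_scope.
Local Open Scope ring_scope.

(* [ipmf X j] is P(X = j) for an integer j; [pmf] is the library's real-indexed
   probability mass function. *)
Definition ipmf d (T : measurableType d) (R : realType) (P : probability T R)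
    (X : {RV P >-> R}) (j : int) : R :=
  pmf X j%:~R.

Definition integer_valued d (T : measurableType d) (R : realType)
    (P : probability T R) (X : {RV P >-> R}) : Prop :=
  forall t : T, X t \is a Num.int.

Definition isupport d (T : measurableType d) (R : realType)
    (P : probability T R) (X : {RV P >-> R}) : set int :=
  [set j | 0 < ipmf X j].

Definition proportional (R : realType) (f g : int -> R) : Prop :=
  exists c : R, forall j, f j = c * g j.

(* X ~ CO(mu; q).  The sum over k <= j runs over k = j - m, m = 0, 1, 2, ...;
   it converges absolutely because X is integrable. *)
Definition CO d (T : measurableType d) (R : realType) (P : probability T R)
    (X : {RV P >-> R}) (mu : R) (q : {poly R}) : Prop :=
  [/\ integer_valued X,
      P.-integrable [set: T] (EFin \o X),
      ('E_P[X] = mu%:E)%E,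
      (size q <= 3)%N
    & forall j : int,
        series (fun m : nat =>
          (mu - (j - m%:Z)%:~R) * ipmf X (j - m%:Z)) @ \oo
        --> q.[j%:~R] * ipmf X j].

Definition abs_moment d (T : measurableType d) (R : realType)
    (P : probability T R) (X : {RV P >-> R}) (k : nat) : \bar R :=
  ('E_P[fun t => (`|X t| ^+ k)%R])%E.

(* f^{[k]}(x) = f(x) f(x+1) ... f(x+k-1) *)
Definition rising (R : realType) (f : R -> R) (k : nat) (x : R) : R :=
  \prod_(l < k) f (x + l%:R).

(* (z)_k *)
Definition desc_fact (R : realType) (z : R) (k : nat) : R :=
  \prod_(l < k) (z - l%:R).

(* [z]_k *)
Definition asc_fact (R : realType) (z : R) (k : nat) : R :=
  \prod_(l < k) (z + l%:R).

(* Pi_delta^{[k]}(m) *)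
Definition Pi_prod (R : realType) (delta : R) (k m : nat) : R :=
  \prod_(m <= j < k + m) (1 - j%:R * delta).

Definition quad (R : realType) (delta beta gamma : R) : {poly R} :=
  delta *: 'X^2 + beta *: 'X + gamma%:P.

Definition mu_ (R : realType) (mu delta beta : R) (i : nat) : R :=
  (delta * i%:R ^+ 2 + beta * i%:R + mu) / (1 - 2 * i%:R * delta).

(* q_i(j) = q(j + i) / (1 - 2 i delta) *)
Definition q_ (R : realType) (delta beta gamma : R) (i : nat) : {poly R} :=
  (1 - 2 * i%:R * delta)^-1 *: (quad delta beta gamma \Po ('X + i%:R%:P)).

Definition delta_ (R : realType) (delta : R) (i : nat) : R :=
  delta / (1 - 2 * i%:R * delta).

Definition psi (R : realType) (mu delta beta gamma : R) (x : R) : R :=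
  (quad delta beta gamma).[(- delta * x ^+ 2 + (beta + 1) * x + mu)
                           / (1 - 2 * x * delta)]
  / (1 - (2 * x + 1) * delta).

(* Under the moment assumptions the denominators 1 - 2 i delta and
   1 - (2 i + 1) delta are automatically positive, except possibly when the
   support S has at most i + 1, resp. i + 2, points: with masses (1/6, 4/6, 1/6)
   on {0, 1, 2} one has mu = 1, q(j) = (2 - j)(1/2 - j/4), delta = 1/4, and
   mu_2 is the meaningless fraction 0/0.  The two predicates below say that the
   formulas are meaningful in these exceptional cases; they hold trivially when
   S is infinite. *)
Definition mu_q_defined (R : realType) (S : set int) (delta : R) (i : nat) :
    Prop :=
  S #<= `I_i.+1 -> 1 - 2 * i%:R * delta != 0.

Definition psi_defined (R : realType) (S : set int) (delta : R) (i : nat) :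
    Prop :=
  mu_q_defined S delta i /\
  (S #<= `I_i.+2 -> 1 - (2 * i%:R + 1) * delta != 0).

(* mu_(r) and mu_[r] *)
Definition desc_moment d (T : measurableType d) (R : realType)
    (P : probability T R) (X : {RV P >-> R}) (r : nat) : R :=
  fine ('E_P[fun t => desc_fact (X t) r])%E.

Definition asc_moment d (T : measurableType d) (R : realType)
    (P : probability T R) (X : {RV P >-> R}) (r : nat) : R :=
  fine ('E_P[fun t => asc_fact (X t) r])%E.

(* Main.v *)
(* Subtracting consecutive partial sums, X ~ CO(mu; q) means
   q(j) p(j) - q(j-1) p(j-1) = (mu - j) p(j) for all j.  Summation by parts against
   a polynomial g gives the covariance identity
   E[(X - mu) g(X)] = E[q(X) (g(X + 1) - g(X))]; the boundary terms vanish because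
   they converge and a nonzero limit would make a finite moment dominate a multiple
   of the harmonic series.  Taking for g the factorials (x)_r, (x-1)[x]_{r-1}, [x]_r
   and (x-1)_r yields the four recurrences.  The weights w_i = q^{[i]} p satisfy
   w_{i+1}(j) - w_{i+1}(j-1) = (delta i^2 + beta i + mu - (1 - 2 i delta) j) w_i(j),
   which is the CO equation of X_i once 1 - 2 i delta <> 0; the variance and the
   moments E q^{[i]}(X) follow from the covariance identity applied to X_i. *)

Require Import Defs.
From HB Require Import structures.
From mathcomp Require Import all_boot all_order all_algebra.
From mathcomp Require Import all_classical all_reals all_analysis.
From mathcomp Require Import measurable_realfun ring lra zify.

Set Implicit Arguments.
Unset Strict Implicit.
Unset Printing Implicit Defensive.

Import Order.TTheory GRing.Theory Num.Theory.
Import numFieldNormedType.Exports.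

Local Open Scope classical_set_scope.
Local Open Scope card_scope.
Local Open Scope ring_scope.

(** * Sums over the integers and telescoping *)

(** No sign of [q] is assumed and no denominator is known to be nonzero in advance; this shapes the
    order of the argument. Positivity of q^{[i]} p comes from the product q p itself, which
    increases up to mu, decreases beyond it and tends to 0 at both infinities. The relation between
    w_{i+1} and w_i is free of division, so it can be used to prove 1 - 2 i delta > 0 as soon as
    w_{i+1} is positive somewhere. For 1 - (2 i + 1) delta the obstruction is a q_i of leading
    coefficient 1, and excluding it takes a point where w_{i+2} is positive. Supports too short to
    provide such points are the exceptional cases of the definitions. Degree counts are tight:
    q^{[i]} costs 2 i moments, and each telescoped quantity has one degree more than the available
    moments control. Plain domination thus cannot kill the boundary terms, and the harmonic series
    has to step in. *)

Section IntegerSums.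
Variable R : realType.
Implicit Types (f g w : int -> R) (a b : {poly R}).

(* The negative integers are reached through [Negz n], which is [-(n+1)]. *)
Definition isum f (l : R) : Prop :=
  series (fun n => f n%:Z + f (Negz n)) @ \oo --> l.

(** The weight (1 + |j|)^k is monotone and multiplicative in [k], also at j = 0, and bounds every
    polynomial of degree at most [k] up to a constant. *)
Definition has_moment (k : nat) w : Prop :=
  cvgn (series (fun n : nat => (1 + `|n%:Z%:~R|) ^+ k * w n%:Z
                             + (1 + `|(Negz n)%:~R|) ^+ k * w (Negz n))).

Lemma isum_unique f l m : isum f l -> isum f m -> l = m.
Proof. by move=> fl fm; apply: (cvg_unique _ fl fm). Qed.

Lemma eq_isum f g l : f =1 g -> isum f l -> isum g l.
Proof. by move=> /funext ->. Qed.

Lemma isumD f g l m : isum f l -> isum g m -> isum (fun j => f j + g j) (l + m).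
Proof.
move=> fl gm; rewrite /isum (_ : series _ =
  series (fun n => f n%:Z + f (Negz n)) + series (fun n => g n%:Z + g (Negz n))).
  exact: cvgD.
by rewrite -seriesD; congr series; apply/funext => n /=; rewrite addrACA.
Qed.

Lemma isumZ f l (c : R) : isum f l -> isum (fun j => c * f j) (c * l).
Proof.
move=> fl; rewrite /isum (_ : series _ =
  c *: series (fun n => f n%:Z + f (Negz n))).
  exact: cvgZr.
by rewrite -seriesZ; congr series; apply/funext => n /=; rewrite -mulrDr.
Qed.

Lemma isum0 : isum (fun=> 0) 0.
Proof.
rewrite /isum (_ : series _ = cst 0); first exact: cvg_cst.
by apply/funext => n; rewrite /series /= big1// => i _; rewrite addr0.
Qed.

Lemma isum_sum (I : Type) (r : seq I) (F : I -> int -> R) (l : I -> R) :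
  (forall i, isum (F i) (l i)) ->
  isum (fun j => \sum_(i <- r) F i j) (\sum_(i <- r) l i).
Proof.
move=> Fl; elim: r => [|i r IH].
  by rewrite big_nil; apply: eq_isum isum0 => j; rewrite big_nil.
rewrite big_cons; apply: (eq_isum _ (isumD (Fl i) IH)) => j.
by rewrite big_cons.
Qed.

Lemma isum_ge f l j : (forall i, 0 <= f i) -> isum f l -> f j <= l.
Proof.
move=> f0 fl.
have nd : {homo series (fun n => f n%:Z + f (Negz n)) : m n / (m <= n)%N >-> m <= n}.
  by apply: nondecreasing_series => n _ _; rewrite addr_ge0.
have le n : series (fun n => f n%:Z + f (Negz n)) n <= l.
  by rewrite -(cvg_lim _ fl)//; apply: nondecreasing_cvgn_le => //; apply: cvgP fl.
have S_ge n : f n%:Z + f (Negz n) <= l.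
  apply: le_trans (le n.+1); rewrite seriesEnat /= big_nat_recr//=.
  by rewrite lerDr sumr_ge0// => i _; rewrite addr_ge0.
case: j => n; apply: le_trans (S_ge n); first by rewrite lerDl.
by rewrite lerDr.
Qed.

Lemma horner_growth (f : {poly R}) k : (size f <= k.+1)%N ->
  exists2 C, 0 <= C & forall x, `|f.[x]| <= C * (1 + `|x|) ^+ k.
Proof.
move=> sf; exists (\sum_(i < k.+1) `|f`_i|); first exact: sumr_ge0.
move=> x; rewrite (horner_coef_wide _ sf) mulr_suml.
apply: le_trans (ler_norm_sum _ _ _) _; apply: ler_sum => i _.
rewrite normrM ler_wpM2l// normrX.
have x1 : 1 <= 1 + `|x| by rewrite lerDl.
apply: (@le_trans _ _ ((1 + `|x|) ^+ i)).
  by rewrite lerXn2r ?nnegrE// lerDr.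
by rewrite ler_weXn2l// -ltnS.
Qed.

Lemma size_mul_leq a b m n : (size a <= m)%N -> (size b <= n)%N ->
  (size (a * b)%R <= (m + n).-1)%N.
Proof.
move=> am bn; apply: leq_trans (size_polyMleq _ _) _.
by rewrite -!subn1 leq_sub2r// leq_add.
Qed.

Lemma size_shift_poly a (c : R) : size (a \Po ('X + c%:P)) = size a.
Proof. by rewrite size_comp_poly2// size_XaddC. Qed.

Lemma dominated_series (u v : R ^nat) :
  (forall n, `|u n| <= v n) -> cvgn (series v) -> cvgn (series u).
Proof.
move=> uv cv; apply: normed_cvg; apply: series_le_cvg cv => //.
  by move=> n /=.
by move=> n; apply: le_trans (uv n).
Qed.

Lemma cvg_seriesZ (c : R) (u : R ^nat) :
  cvgn (series u) -> cvgn (series (fun n => c * u n)).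
Proof. exact: is_cvg_seriesZ. Qed.
Arguments cvg_seriesZ c {u}.

Section Dominated.
Variables (k : nat) (w : int -> R).
Hypotheses (w_ge0 : forall j, 0 <= w j) (wk : has_moment k w).

Let g j := (1 + `|j%:~R|) ^+ k * w j.

Let g_ge0 j : 0 <= g j.
Proof. by rewrite mulr_ge0// exprn_ge0// addr_ge0. Qed.

Lemma moment_cvg_pos : cvgn (series (fun n : nat => (1 + `|n%:Z%:~R|) ^+ k * w n%:Z)).
Proof.
apply: series_le_cvg wk => n; [exact: (g_ge0 n)| |].
  exact: addr_ge0 (g_ge0 n) (g_ge0 (Negz n)).
by rewrite lerDl; exact: (g_ge0 (Negz n)).
Qed.

Lemma moment_cvg_neg :
  cvgn (series (fun n : nat => (1 + `|(Negz n)%:~R|) ^+ k * w (Negz n))).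
Proof.
apply: series_le_cvg wk => n; [exact: (g_ge0 (Negz n))| |].
  exact: addr_ge0 (g_ge0 n) (g_ge0 (Negz n)).
by rewrite lerDr; exact: (g_ge0 n).
Qed.

(** The two one-sided series are kept apart because the limits of the boundary terms at the two
    infinities are established separately. *)
Lemma moment_poly a : (size a <= k.+1)%N ->
  [/\ cvgn (series (fun n : nat => a.[n%:Z%:~R] * w n%:Z)),
      cvgn (series (fun n : nat => a.[(Negz n)%:~R] * w (Negz n)))
    & exists l, isum (fun j => a.[j%:~R] * w j) l].
Proof.
move=> /horner_growth[C C0 aC].
have bnd j : `|a.[j%:~R] * w j| <= C * g j.
  by rewrite normrM (ger0_norm (w_ge0 j)) mulrA ler_wpM2r.
have P1 : cvgn (series (fun n : nat => a.[n%:Z%:~R] * w n%:Z)).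
  by apply: dominated_series (cvg_seriesZ C moment_cvg_pos) => n; exact: bnd.
have P2 : cvgn (series (fun n : nat => a.[(Negz n)%:~R] * w (Negz n))).
  by apply: dominated_series (cvg_seriesZ C moment_cvg_neg) => n; exact: bnd.
split=> //; have := is_cvg_seriesD P1 P2 => /cvg_ex[l hl].
by exists l.
Qed.

End Dominated.

Lemma has_moment_poly k m w v a : (forall j, 0 <= w j) -> (forall j, 0 <= v j) ->
  (size a <= m.+1)%N -> (forall j, v j = a.[j%:~R] * w j) ->
  has_moment (k + m) w -> has_moment k v.
Proof.
move=> w0 v0 /horner_growth[C C0 aC] va wkm.
have bnd j : (1 + `|j%:~R|) ^+ k * v j <= C * ((1 + `|j%:~R|) ^+ (k + m) * w j).
  rewrite exprD -!mulrA mulrCA ler_wpM2l ?exprn_ge0 ?addr_ge0//.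
  by rewrite mulrA -(ger0_norm (v0 j)) va normrM (ger0_norm (w0 j)) ler_wpM2r.
apply: series_le_cvg (cvg_seriesZ C wkm) => n.
- by rewrite addr_ge0// mulr_ge0// exprn_ge0// addr_ge0.
- by rewrite mulr_ge0// addr_ge0// mulr_ge0// exprn_ge0// addr_ge0.
- by rewrite mulrDr lerD.
Qed.

Lemma has_moment_le k m w : (forall j, 0 <= w j) -> (k <= m)%N ->
  has_moment m w -> has_moment k w.
Proof.
move=> w0 km wm; apply: (@has_moment_poly k (m - k) w w 1) => //.
- by rewrite size_poly1.
- by move=> j; rewrite hornerE mul1r.
- by rewrite subnKC.
Qed.

Lemma has_momentZ k w c : has_moment k w -> has_moment k (fun j => c * w j).
Proof.
move=> /(cvg_seriesZ c); rewrite /has_moment.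
by under eq_fun do rewrite mulrDr !(mulrCA c).
Qed.

(* A nonzero limit would make [a] dominate a multiple of the harmonic series. *)
Lemma cvg0_harmonic (u a : R ^nat) : cvgn u -> cvgn (series a) ->
  (forall n, `|u n| <= n.+1%:R * a n) -> u @ \oo --> 0.
Proof.
move=> /cvg_ex[L uL] ca ua; have [L0|L0] := eqVneq L 0; first by rewrite -L0.
exfalso; apply: (@dvg_harmonic R).
have L2 : 0 < `|L| / 2 by rewrite divr_gt0// normr_gt0.
have : \forall n \near \oo, `|L - u n| < `|L| / 2.
  by move/cvgrPdist_lt : uL; exact.
move=> [N _ HN].
(* The comparison is only available from [N] on; deleting the first terms does not affect
   divergence. *)
pose h n : R := if (n < N)%N then 0 else harmonic n.
have ch : cvgn (series h).
  apply: dominated_series (cvg_seriesZ (`|L| / 2)^-1 ca) => n.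
  have a0 : 0 <= a n.
    by rewrite -(pmulr_rge0 _ (ltr0Sn R n)); exact: le_trans (ua n).
  rewrite /h; case: ltnP => Nn.
    by rewrite normr0 mulr_ge0// invr_ge0 ltW.
  have Lu : `|L| / 2 <= n.+1%:R * a n.
    apply: le_trans (ua n); have := HN n Nn => /ltW.
    by have := lerB_dist L (u n); lra.
  rewrite ger0_norm /harmonic/= ?invr_ge0// [leRHS]mulrC ler_pdivlMr//.
  by rewrite ler_pdivrMl.
rewrite -(is_cvg_series_restrict N) in ch; rewrite -(is_cvg_series_restrict N).
rewrite (_ : [sequence _]_n = [sequence \sum_(N <= k < n) h k]_n)//.
apply/funext => n /=; apply: eq_big_nat => i /andP[Ni _].
by rewrite /h ltnNge Ni.
Qed.

Section Telescoping.
Variables (k : nat) (w : int -> R) (a b : {poly R}).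
Hypotheses (w_ge0 : forall j, 0 <= w j) (wk : has_moment k w).
Hypotheses (sa : (size a <= k.+1)%N) (sb : (size b <= k.+2)%N).
Hypothesis ab : forall j : int,
  b.[j%:~R] * w j - b.[(j - 1)%:~R] * w (j - 1) = a.[j%:~R] * w j.

Let B j := b.[j%:~R] * w j.

Let seriesP N : series (fun n : nat => a.[n%:Z%:~R] * w n%:Z) N = B (N%:Z - 1) - B (-1).
Proof.
elim: N => [|N IH]; first by rewrite /series /= big_geq// subrr.
rewrite seriesSr IH -ab (_ : N.+1%:Z - 1 = N%:Z); last by lia.
by rewrite /B; ring.
Qed.

Let seriesN N :
  series (fun n : nat => a.[(Negz n)%:~R] * w (Negz n)) N = B (-1) - B (Negz N).
Proof.
elim: N => [|N IH]; first by rewrite /series /= big_geq// subrr.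
rewrite seriesSr IH -ab (_ : Negz N - 1 = Negz N.+1); last by lia.
by rewrite /B; ring.
Qed.

(** The degree of [b] may exceed the moment order by one, so its growth bound is n + 1 times a
    summable term, exactly what [cvg0_harmonic] accepts. Existence of the limit comes from the
    series of [a], whose partial sums are these terms up to a constant. *)
Lemma boundary_pos : (fun n : nat => b.[n%:Z%:~R] * w n%:Z) @ \oo --> 0.
Proof.
have [C C0 bC] := horner_growth sb.
apply: (cvg0_harmonic _ (cvg_seriesZ C (moment_cvg_pos w_ge0 wk))).
  have [/cvg_ex[l hl] _ _] := moment_poly w_ge0 wk sa.
  apply/cvg_ex; exists (l + B (-1)).
  rewrite (_ : (fun _ => _) = (fun n =>
    series (fun n : nat => a.[n%:Z%:~R] * w n%:Z) (n + 1)%N + B (-1))).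
    by apply: cvgD (cvg_cst _); rewrite cvg_shiftn.
  apply/funext => n; rewrite seriesP subrK /B (_ : (n + 1)%:Z - 1 = n%:Z)//.
  by lia.
move=> n; rewrite normrM (ger0_norm (w_ge0 _)).
apply: le_trans (ler_wpM2r (w_ge0 _) (bC _)) _.
rewrite exprS le_eqVlt; apply/orP; left; apply/eqP.
rewrite (_ : 1 + `|n%:Z%:~R| = n.+1%:R); first by ring.
by rewrite ger0_norm// -natr1 addrC.
Qed.

Lemma boundary_neg : (fun n => b.[(Negz n)%:~R] * w (Negz n)) @ \oo --> 0.
Proof.
have [C C0 bC] := horner_growth sb.
(* The factor 2 pays for the offset of [Negz]: 1 + |-(n+1)| = n + 2 <= 2 (n + 1). *)
apply: (cvg0_harmonic _ (cvg_seriesZ (2 * C) (moment_cvg_neg w_ge0 wk))).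
  have [_ /cvg_ex[l hl] _] := moment_poly w_ge0 wk sa.
  apply/cvg_ex; exists (B (-1) - l).
  rewrite (_ : (fun _ => _) = (fun n => B (-1) -
    series (fun n : nat => a.[(Negz n)%:~R] * w (Negz n)) n)).
    by apply: cvgB => //; apply: cvg_cst.
  by apply/funext => n; rewrite seriesN opprB addrC subrK.
move=> n; rewrite normrM (ger0_norm (w_ge0 _)).
apply: le_trans (ler_wpM2r (w_ge0 _) (bC _)) _.
rewrite exprS; set x := `|_|; set y := (1 + x) ^+ k.
have -> : C * ((1 + x) * y) * w (Negz n) = (1 + x) * (C * (y * w (Negz n))) by ring.
have -> : n.+1%:R * (2 * C * (y * w (Negz n))) =
  (n.+1%:R * 2) * (C * (y * w (Negz n))) by ring.
apply: ler_wpM2r.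
  by rewrite mulr_ge0// mulr_ge0// exprn_ge0// /x addr_ge0.
have -> : x = n.+1%:R by rewrite /x NegzE mulrNz normrN ger0_norm.
by rewrite mulr_natr mulr2n lerD2r ler1n.
Qed.

Lemma isum_telescope : isum (fun j => a.[j%:~R] * w j) 0.
Proof.
have [_ _ [l hl]] := moment_poly w_ge0 wk sa.
pose S n := series (fun n => a.[n%:Z%:~R] * w n%:Z + a.[(Negz n)%:~R] * w (Negz n)) n.
have SE : (fun n : nat => S n.+1) = (fun n : nat => B n%:Z - B (Negz n.+1)).
  apply/funext => n; rewrite /S (_ : series _ _ =
    series (fun n : nat => a.[n%:Z%:~R] * w n%:Z) n.+1 +
    series (fun n : nat => a.[(Negz n)%:~R] * w (Negz n)) n.+1).
    by rewrite seriesP seriesN (_ : n.+1%:Z - 1 = n%:Z); [ring|lia].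
  by rewrite /series /= -big_split.
have S0 : S n.+1 @[n --> \oo] --> (0 : R).
  rewrite SE -(subrr 0); apply: cvgB; first exact: boundary_pos.
  have := boundary_neg; rewrite -cvg_shiftS; exact.
have Sl : S n.+1 @[n --> \oo] --> l by rewrite cvg_shiftS.
by have -> : 0 = l by exact: (cvg_unique _ S0 Sl).
Qed.

End Telescoping.

End IntegerSums.
Arguments isumZ {R f l} c _.

Arguments cvg_seriesZ {R} c {u}.

(** * Weights satisfying the Cumulative Ord equation *)

Section CumulativeOrd.
Variable R : realType.
Implicit Types (w v : int -> R) (q : {poly R}).

(* The defining identity of CO(mu; q), differenced in j. *)
Definition co_weights w (mu : R) q : Prop := forall j : int,
  q.[j%:~R] * w j - q.[(j - 1)%:~R] * w (j - 1) = (mu - j%:~R) * w j.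

Lemma cvg_ler_const (u : R ^nat) (l c : R) : u @ \oo --> l ->
  (\forall n \near \oo, u n <= c) -> l <= c.
Proof.
move=> ul uc; rewrite -(cvg_lim _ ul)//; apply: limr_le => //.
exact: cvgP ul.
Qed.

Lemma nondecreasing_from_ninfty (h : int -> R) j :
  (fun n => h (Negz n)) @ \oo --> 0 ->
  (forall i, i <= j -> h (i - 1) <= h i) -> 0 <= h j.
Proof.
move=> h0 hj; apply: (cvg_ler_const h0); exists `|j|%N => // n /= jn.
have H m : h (j - m%:Z) <= h j.
  elim: m => [|m IH]; first by rewrite subr0.
  apply: le_trans IH; rewrite (_ : j - m.+1%:Z = j - m%:Z - 1); last by lia.
  by apply: hj; lia.
have -> : Negz n = j - (absz (j + n.+1%:Z))%:Z by lia.
exact: H.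
Qed.

Lemma nonincreasing_to_pinfty (h : int -> R) j :
  (fun n : nat => h n%:Z) @ \oo --> 0 ->
  (forall i, j <= i -> h (i + 1) <= h i) -> 0 <= h j.
Proof.
move=> h0 hj; apply: (cvg_ler_const h0); exists `|j|%N => // n /= jn.
have H m : h (j + m%:Z) <= h j.
  elim: m => [|m IH]; first by rewrite addr0.
  apply: le_trans IH; rewrite (_ : j + m.+1%:Z = j + m%:Z + 1); last by lia.
  by apply: hj; lia.
have -> : n%:Z = j + (absz (n%:Z - j))%:Z by lia.
exact: H.
Qed.

Section CoWeights.
Variables (w : int -> R) (mu : R) (q : {poly R}).
Hypotheses (w_ge0 : forall j, 0 <= w j) (w_rec : co_weights w mu q).
Hypothesis sq : (size q <= 3)%N.

(** Telescopes q(j) g(j + 1) w(j). With [g] shifted, the value at j - 1 is g(j) times q(j - 1) w(j -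
    1), to which [w_rec] applies directly. The difference [dg] is a separate argument so that its
    lower degree can be stated. *)
Lemma stein k (g dg : {poly R}) : has_moment k.+1 w ->
  (size g <= k.+1)%N -> (size dg <= k)%N ->
  (forall x, g.[x + 1] - g.[x] = dg.[x]) ->
  isum (fun j => (q.[j%:~R] * dg.[j%:~R] - (j%:~R - mu) * g.[j%:~R]) * w j) 0.
Proof.
move=> wk sg sdg dgE.
have := @isum_telescope _ k.+1 w (q * dg - ('X - mu%:P) * g) (q * (g \Po ('X + 1%:P)))
  w_ge0 wk.
set A := isum _ _ => H.
suff : A by apply: eq_isum => j; rewrite !hornerE.
apply: H.
- apply: leq_trans (size_polyD _ _) _; rewrite size_polyN geq_max.
  rewrite (size_mul_leq sq sdg)/=.
  by apply: (@size_mul_leq _ _ _ 2 k.+1); rewrite ?size_XsubC.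
- by apply: (@size_mul_leq _ _ _ 3 k.+1); rewrite ?size_shift_poly.
- move=> j; rewrite !hornerM !horner_comp !hornerE -!dgE.
  rewrite (_ : (j - 1)%:~R + 1 = j%:~R :> R); last by rewrite intrD addrNK.
  have := w_rec j; set A' := q.[_] * _; set B' := q.[_] * _ => /eqP.
  rewrite subr_eq addrC -subr_eq => /eqP e.
  have -> : q.[(j - 1)%:~R] * g.[j%:~R] * w (j - 1) = g.[j%:~R] * B' by rewrite /B'; ring.
  by rewrite -e /A'; ring.
Qed.

Lemma sub_X_size : (size (mu%:P - 'X)%R <= 2)%N.
Proof. by rewrite -opprB size_polyN size_XsubC. Qed.

Lemma co_rec_poly j : q.[j%:~R] * w j - q.[(j - 1)%:~R] * w (j - 1) =
  (mu%:P - 'X).[j%:~R] * w j.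
Proof. by rewrite !hornerE. Qed.

Section Positivity.
Hypothesis w1 : has_moment 1 w.

Let qw_pos := boundary_pos w_ge0 w1 sub_X_size sq co_rec_poly.
Let qw_neg := boundary_neg w_ge0 w1 sub_X_size sq co_rec_poly.

(** The increments (mu - j) w(j) are nonnegative up to mu and nonpositive after it, and the product
    vanishes at both infinities; compare with the end on the same side of mu. *)
Lemma co_mul_ge0 j : 0 <= q.[j%:~R] * w j.
Proof.
have [jmu|jmu] := leP j%:~R mu.
  apply: (nondecreasing_from_ninfty (h := fun j => q.[j%:~R] * w j)) => //.
  move=> i ij; rewrite -subr_ge0 w_rec mulr_ge0// subr_ge0.
  by apply: le_trans jmu; rewrite ler_int.
apply: (nonincreasing_to_pinfty (h := fun j => q.[j%:~R] * w j)) => //.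
move=> i ij; rewrite -subr_le0; have := w_rec (i + 1); rewrite addrK => ->.
rewrite mulr_le0_ge0// subr_le0; apply: (le_trans (ltW jmu)).
by rewrite ler_int; lia.
Qed.

Lemma co_horner_gt0 j : 0 < w j -> 0 < w (j + 1) -> 0 < q.[j%:~R].
Proof.
move=> wj wj1; rewrite -(pmulr_lgt0 _ wj).
have [jmu|jmu] := ltP j%:~R mu.
  have := w_rec j; have := co_mul_ge0 (j - 1).
  have : 0 < (mu - j%:~R) * w j by rewrite mulr_gt0// subr_gt0.
  by lra.
(* From mu on, strictness comes from the next step: q w falls strictly between j and j + 1 and is
   still nonnegative at j + 1. *)
have := w_rec (j + 1); rewrite addrK; have := co_mul_ge0 (j + 1).
have : 0 < ((j + 1)%:~R - mu) * w (j + 1).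
  by rewrite mulr_gt0// subr_gt0 (le_lt_trans jmu)// ltr_int; lia.
lra.
Qed.

(** This zero of [q] at a right end point of the support is what cuts the support of q^{[i]} p down
    by i points. *)
Lemma co_horner_eq0 j : 0 < w j -> w (j + 1) = 0 -> q.[j%:~R] = 0.
Proof.
move=> wj wj1; have := w_rec (j + 1); rewrite addrK wj1 !mulr0 sub0r => /eqP.
by rewrite oppr_eq0 mulf_eq0 (gt_eqF wj) orbF => /eqP.
Qed.

End Positivity.

Lemma horner_size3 (p : {poly R}) x : (size p <= 3)%N ->
  p.[x] = p`_2 * x ^+ 2 + p`_1 * x + p`_0.
Proof.
by move=> sp; rewrite (horner_coef_wide _ sp) !big_ord_recr big_ord0 /=; ring.
Qed.

(* When the leading coefficient is 1, [q] has [mu] as a root; calling [nu] the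
   other one, [q.[j] * (j + 1 - nu) * w j] does not depend on [j], hence vanishes. *)
Lemma co_lead_neq1 j : has_moment 2 w ->
  q.[mu] = 0 -> 0 < q.[j%:~R] * w j -> 0 < q.[(j + 1)%:~R] * w (j + 1) ->
  q`_2 != 1.
Proof.
move=> w2 qmu qj qj1; apply/eqP => q2.
(* By Vieta: [q] is monic and its roots sum to minus the linear coefficient. *)
pose nu := - q`_1 - mu.
have qE x : q.[x] = (x - mu) * (x - nu).
  rewrite horner_size3// q2; move: qmu; rewrite horner_size3// q2 /nu => e.
  have -> : q`_0 = - (1 * mu ^+ 2 + q`_1 * mu) by move: e; lra.
  by ring.
pose b := q * ('X - (nu - 1)%:P).
pose B j := b.[j%:~R] * w j.
have Brec i : B i - B (i - 1) = (0 : {poly R}).[i%:~R] * w i.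
  have := w_rec i; rewrite /B /b !hornerE.
  set A' := q.[i%:~R] * _; set B' := q.[_] * w (i - 1) => e.
  have -> : q.[(i - 1)%:~R] * ((i - 1)%:~R - (nu - 1)) * w (i - 1) =
     (i%:~R - nu) * B' by rewrite /B' intrD; ring.
  have -> : B' = A' - (mu - i%:~R) * w i by rewrite -e; ring.
  by rewrite /A' qE; ring.
have Bcst i : B i = B 0.
  have H n : B n%:Z = B 0 /\ B (- n%:Z) = B 0.
    elim: n => [|n [IH1 IH2]]; first by rewrite oppr0.
    split.
      have := Brec n.+1%:Z; rewrite hornerE mul0r (_ : _ - 1 = n%:Z); last by lia.
      by move/eqP; rewrite subr_eq0 IH1 => /eqP.
    have := Brec (- n%:Z); rewrite hornerE mul0r (_ : _ - 1 = - n.+1%:Z); last by lia.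
    by move/eqP; rewrite subr_eq0 IH2 => /eqP.
  case: i => n; first by case: (H n).
  by rewrite NegzE; case: (H n.+1).
have B0 : B 0 = 0.
  (* The increments are zero, so [a] = 0, and two moments suffice for the cubic [b]. *)
  have := @boundary_pos _ 2 w 0 b w_ge0 w2.
  rewrite size_poly0 => /(_ isT) H.
  have {}H : (fun n : nat => B n%:Z) @ \oo --> (0 : R).
    apply: H => //; apply: leq_trans (size_polyMleq _ _) _.
    by rewrite size_XsubC; lia.
  have H' : (fun n : nat => B n%:Z) @ \oo --> B 0.
    by under eq_fun do rewrite Bcst; exact: cvg_cst.
  exact: (cvg_unique _ H' H).
(* The vanishing product leaves one possible point, whereas both j and j + 1 qualify. *)
have K i : 0 < q.[i%:~R] * w i -> i%:~R = nu - 1.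
  move=> qi; have := Bcst i; rewrite B0 /B /b !hornerE mulrAC => /eqP.
  by rewrite mulf_eq0 (gt_eqF qi) subr_eq0 => /eqP.
by have := K _ qj; rewrite -(K _ qj1) => /eqP; rewrite eqr_int; lia.
Qed.

(** The covariance identity with g = 1 gives a centred first moment 0, and with g = X - mu it
    identifies the sum of q w with the variance sum V. Expanding [q] around mu then gives V = q_2 V
    + q(mu) s. It is left undivided because the case q_2 = 1 is also needed: it forces q(mu) s =
    0. *)
Lemma co_variance s : has_moment 2 w -> isum w s ->
  exists V, [/\ isum (fun j => (j%:~R - mu) ^+ 2 * w j) V,
    isum (fun j => q.[j%:~R] * w j) V & (1 - q`_2) * V = q.[mu] * s].
Proof.
move=> w2 ws.
have w1 : has_moment 1 w by exact: has_moment_le w2.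
have S0 : isum (fun j => (j%:~R - mu) * w j) 0.
  have := @stein 0 1 0 w1; rewrite size_poly1 size_poly0 => /(_ isT isT).
  have e1 x : (1 : {poly R}).[x + 1] - (1 : {poly R}).[x] = (0 : {poly R}).[x].
    by rewrite !hornerE subrr.
  move=> /(_ e1) H.
  have := isumZ (-1) H; rewrite mulr0; apply: eq_isum => j.
  by rewrite !hornerE /=; ring.
have S1 : isum (fun j => (q.[j%:~R] - (j%:~R - mu) ^+ 2) * w j) 0.
  have := @stein 1 ('X - mu%:P) 1 w2; rewrite size_XsubC size_poly1 => /(_ isT isT) H.
  apply: eq_isum (H _) => [j|x]; first by rewrite !hornerE; ring.
  by rewrite !hornerE; ring.
have s2 : (size (('X - mu%:P) ^+ 2)%R <= 3)%N by rewrite size_exp_XsubC.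
have [_ _ [V hV]] := moment_poly w_ge0 w2 s2.
have {}hV : isum (fun j => (j%:~R - mu) ^+ 2 * w j) V.
  by apply: eq_isum hV => j; rewrite !hornerE.
exists V; have qV : isum (fun j => q.[j%:~R] * w j) V.
  by have := isumD S1 hV; rewrite add0r; apply: eq_isum => j; ring.
split=> //.
have := isumD (isumZ q`_2 hV) (isumD (isumZ (2 * q`_2 * mu + q`_1) S0) (isumZ q.[mu] ws)).
move=> H; have VE : V = q`_2 * V + ((2 * q`_2 * mu + q`_1) * 0 + q.[mu] * s).
  apply: isum_unique qV (eq_isum _ H).
  by move=> j; rewrite !horner_size3//; ring.
by rewrite mulrBl mul1r {1}VE; ring.
Qed.

End CoWeights.
End CumulativeOrd.

(** * The weights q^{[i]} p *)

Section RisingWeights.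
Variable R : realType.
Implicit Types (w : int -> R) (q : {poly R}).

Definition rising_poly q (i : nat) : {poly R} :=
  \prod_(l < i) (q \Po ('X + l%:R%:P)).

Lemma rising_polyE q i x : (rising_poly q i).[x] = rising (horner q) i x.
Proof.
rewrite /rising_poly horner_prod; apply: eq_bigr => l _.
by rewrite horner_comp !hornerE.
Qed.

Lemma size_rising_poly q i : (size q <= 3)%N -> (size (rising_poly q i) <= (2 * i).+1)%N.
Proof.
move=> sq; rewrite /rising_poly; elim: i => [|i IH].
  by rewrite big_ord0 size_poly1.
rewrite big_ord_recr (_ : (2 * i.+1).+1 = ((2 * i).+1 + 3).-1)%N; last by lia.
by apply: size_mul_leq => //; rewrite size_shift_poly.
Qed.

Lemma risingS_r (f : R -> R) i x : rising f i.+1 x = rising f i x * f (x + i%:R).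
Proof. by rewrite /rising big_ord_recr. Qed.

Lemma risingS_l (f : R -> R) i x : rising f i.+1 x = f x * rising f i (x + 1).
Proof.
rewrite /rising big_ord_recl addr0; congr (_ * _); apply: eq_bigr => l _.
by rewrite /= /bump /= natrD addrA.
Qed.

Definition rising_weight q w i j : R := rising (horner q) i j%:~R * w j.

Lemma rising_weight0 q w j : rising_weight q w 0 j = w j.
Proof. by rewrite /rising_weight /rising big_ord0 mul1r. Qed.

Lemma rising_weightS q w i j :
  rising_weight q w i.+1 j = q.[(j + i%:Z)%:~R] * rising_weight q w i j.
Proof. by rewrite /rising_weight risingS_r intrD mulrAC mulrC mulrA. Qed.

Lemma rising_weight_poly q w i j :
  rising_weight q w i j = (rising_poly q i).[j%:~R] * w j.
Proof. by rewrite rising_polyE. Qed.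

(** Splitting off the first factor instead of the last leaves the same product q^{[i]}(j) as in the
    weight at j, and isolates the term handled by the CO equation. *)
Lemma rising_weight_prev q w i j : rising_weight q w i.+1 (j - 1) =
  q.[(j - 1)%:~R] * w (j - 1) * rising (horner q) i j%:~R.
Proof. by rewrite /rising_weight risingS_l intrD addrNK mulrAC. Qed.

Lemma size_quad (delta beta gamma : R) : (size (quad delta beta gamma) <= 3)%N.
Proof.
rewrite /quad; apply: leq_trans (size_polyD _ _) _; rewrite geq_max; apply/andP.
split; last by apply: leq_trans (size_polyC_leq1 _) _.
apply: leq_trans (size_polyD _ _) _; rewrite geq_max; apply/andP; split.
  by apply: leq_trans (size_scale_leq _ _) _; rewrite size_polyXn.
by apply: leq_trans (size_scale_leq _ _) _; rewrite size_polyX.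
Qed.

Lemma horner_quad (delta beta gamma x : R) :
  (quad delta beta gamma).[x] = delta * x ^+ 2 + beta * x + gamma.
Proof. by rewrite /quad !hornerE. Qed.

Section Fixed.
Variables (w : int -> R) (mu delta beta gamma : R).
Let q := quad delta beta gamma.
Hypotheses (w_ge0 : forall j, 0 <= w j) (w_rec : co_weights w mu q).
Hypothesis w1 : has_moment 1 w.
Hypothesis w_conv : forall i j k, i <= j <= k -> 0 < w i -> 0 < w k -> 0 < w j.

Let sq : (size q <= 3)%N := size_quad delta beta gamma.
Let wi := rising_weight q w.
Let N i := delta * i%:R ^+ 2 + beta * i%:R + mu.
Let D i := 1 - 2 * i%:R * delta.

(** Positivity and vanishing are proved in one induction. The new factor q(j + i) is positive while
    j + i + 1 is in the support and zero when j + i is its last point; after that the weight is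
    already zero. [w_conv] rules out re-entering the support. Off the support [q] may be
    negative. *)
Lemma rising_weight_sign i j :
  if (0 < w j) && (0 < w (j + i%:Z)) then (0 < wi i j : Prop) else wi i j = 0.
Proof.
elim: i => [|i]; rewrite /wi.
  by rewrite rising_weight0 addr0 andbb; case: ltP (w_ge0 j) => // ? ?; apply/le_anti/andP.
rewrite rising_weightS (_ : j + i.+1%:Z = j + i%:Z + 1); last by lia.
have [wj|wj] /= := ltP 0 (w j); last by move=> ->; rewrite mulr0.
case: ifP => [wji|wji ->].
  move=> W; case: ifP => wji1.
    by rewrite mulr_gt0// (co_horner_gt0 w_ge0 w_rec).
  rewrite (co_horner_eq0 w_rec) ?mul0r//; apply/eqP.
  by rewrite eq_le w_ge0 leNgt wji1.
case: ifP => [wji1|]; last by rewrite mulr0.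
by move: wji; rewrite (w_conv _ wj wji1)//; lia.
Qed.

Lemma rising_weight_ge0 i j : 0 <= wi i j.
Proof. by have := rising_weight_sign i j; case: ifP => _ => [/ltW|->]. Qed.

Lemma rising_weight_gt0 i j : (0 < wi i j) = (0 < w j) && (0 < w (j + i%:Z)).
Proof. by have := rising_weight_sign i j; case: ifP => _ => [->|->]; rewrite ?ltxx. Qed.

(** After factoring out q^{[i]}(j) w(j), what remains is q(j + i) - q(j) + mu - j, which is affine
    in j because the quadratic terms cancel. *)
Lemma rising_weight_rec i j :
  wi i.+1 j - wi i.+1 (j - 1) = (N i - D i * j%:~R) * wi i j.
Proof.
rewrite /wi rising_weight_prev rising_weightS /rising_weight.
have -> : q.[(j - 1)%:~R] * w (j - 1) = q.[j%:~R] * w j - (mu - j%:~R) * w j.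
  by rewrite -w_rec; ring.
by rewrite /q !horner_quad /N /D intrD /=; ring.
Qed.

Lemma rising_weight_moment i k : has_moment (k + 2 * i) w -> has_moment k (wi i).
Proof.
apply: (has_moment_poly w_ge0 (rising_weight_ge0 i) (size_rising_poly i sq)).
by move=> j; rewrite /wi rising_weight_poly.
Qed.

(** Telescoped over [w], with q^{[i]} absorbed into the polynomials, so that no condition on [D i]
    enters: the result serves to determine its sign. *)
Lemma rising_weight_boundary i : has_moment (2 * i + 1) w ->
  [/\ (fun n : nat => wi i.+1 n%:Z) @ \oo --> 0,
      (fun n : nat => wi i.+1 (Negz n)) @ \oo --> 0
    & isum (fun j => (N i - D i * j%:~R) * wi i j) 0].
Proof.
move=> wk.
pose a := rising_poly q i * ((N i)%:P - (D i)%:P * 'X).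
pose b := rising_poly q i.+1.
have sa : (size a <= (2 * i + 1).+1)%N.
  rewrite (_ : (2 * i + 1).+1 = ((2 * i).+1 + 2).-1)%N; last by lia.
  apply: size_mul_leq; first exact: size_rising_poly.
  apply: leq_trans (size_polyD _ _) _; rewrite size_polyN geq_max.
  rewrite (leq_trans (size_polyC_leq1 _))//=.
  by apply: (@size_mul_leq _ _ _ 1 2); rewrite ?size_polyC_leq1 ?size_polyX.
have sb : (size b <= (2 * i + 1).+2)%N.
  by apply: leq_trans (size_rising_poly i.+1 sq) _; lia.
have ab j : b.[j%:~R] * w j - b.[(j - 1)%:~R] * w (j - 1) = a.[j%:~R] * w j.
  rewrite /b -!rising_weight_poly [LHS]rising_weight_rec /a hornerM.
  by rewrite /wi rising_weight_poly !hornerE /=; ring.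
split.
- have := boundary_pos w_ge0 wk sa sb ab.
  by under eq_fun do rewrite -rising_weight_poly.
- have := boundary_neg w_ge0 wk sa sb ab.
  by under eq_fun do rewrite -rising_weight_poly.
- have := isum_telescope w_ge0 wk sa sb ab; apply: eq_isum => j.
  by rewrite /wi rising_weight_poly /a hornerM !hornerE /=; ring.
Qed.

(* If [D i <= 0], the increments [(N i - D i j) * wi i j] of [wi i.+1] change sign
   at most once, from nonpositive to nonnegative, and [wi i.+1] vanishes at both
   ends: it cannot be positive. *)
Lemma rising_denom_gt0 i j : has_moment (2 * i + 1) w -> 0 < wi i.+1 j -> 0 < D i.
Proof.
move=> wk wj; rewrite ltNge; apply/negP => Di.
have [H1 H2 _] := rising_weight_boundary wk.
have {}H1 : (fun n : nat => - wi i.+1 n%:Z) @ \oo --> 0 by rewrite -oppr0; exact: cvgN.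
have {}H2 : (fun n : nat => - wi i.+1 (Negz n)) @ \oo --> 0 by rewrite -oppr0; exact: cvgN.
suff : 0 <= - wi i.+1 j by rewrite oppr_ge0 leNgt wj.
have [Nj|Nj] := leP (N i - D i * j%:~R) 0.
  apply: (nondecreasing_from_ninfty (h := fun j => - wi i.+1 j)) => // l lj.
  rewrite lerN2 -subr_le0 rising_weight_rec mulr_le0_ge0// ?rising_weight_ge0//.
  apply: le_trans Nj; rewrite lerD2l lerN2 ler_wnM2l// ler_int//.
apply: (nonincreasing_to_pinfty (h := fun j => - wi i.+1 j)) => // l lj.
rewrite lerN2 -subr_ge0 -{2}(addrK 1 l) rising_weight_rec.
rewrite mulr_ge0// ?rising_weight_ge0//; apply: (le_trans (ltW Nj)).
by rewrite lerD2l lerN2 ler_wnM2l// ler_int; lia.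
Qed.

Lemma horner_q_ i x :
  (q_ delta beta gamma i).[x] = (D i)^-1 * q.[x + i%:R].
Proof. by rewrite /q_ hornerZ horner_comp !hornerE. Qed.

Lemma rising_co_weights i (c : R) : D i != 0 ->
  co_weights (fun j => c * wi i j) (mu_ mu delta beta i) (q_ delta beta gamma i).
Proof.
move=> Di j; rewrite !horner_q_.
have E1 : q.[j%:~R + i%:R] * wi i j = wi i.+1 j.
  by rewrite /wi rising_weightS intrD.
have E2 : q.[(j - 1)%:~R + i%:R] * wi i (j - 1) = wi i.+1 (j - 1).
  by rewrite /wi rising_weightS (intrD _ (j - 1)).
have -> : (D i)^-1 * q.[j%:~R + i%:R] * (c * wi i j) -
   (D i)^-1 * q.[(j - 1)%:~R + i%:R] * (c * wi i (j - 1)) =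
   (D i)^-1 * c * (q.[j%:~R + i%:R] * wi i j -
     q.[(j - 1)%:~R + i%:R] * wi i (j - 1)) by ring.
rewrite E1 E2 rising_weight_rec /mu_ -/(N i) -/(D i).
by field.
Qed.

Lemma size_q_ i : (size (q_ delta beta gamma i) <= 3)%N.
Proof.
apply: leq_trans (size_scale_leq _ _) _.
by rewrite size_shift_poly size_quad.
Qed.

Lemma coef_q_2 i : (q_ delta beta gamma i)`_2 = delta_ delta i.
Proof.
have H x := horner_size3 x (size_q_ i).
have E x : (q_ delta beta gamma i).[x] = (D i)^-1 * (delta * (x + i%:R) ^+ 2 +
  beta * (x + i%:R) + gamma) by rewrite horner_q_ horner_quad.
move: (H 0) (H 1) (H (-1)); rewrite !E /delta_ -/(D i).
set p2 := _`_2; set p1 := _`_1; set p0 := _`_0; set I := (D i)^-1.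
move=> e0 e1 e2.
(* The leading coefficient is read off as half the second difference at 0. *)
have -> : p2 = ((p2 * 1 ^+ 2 + p1 * 1 + p0) + (p2 * (-1) ^+ 2 + p1 * -1 + p0)) / 2
  - (p2 * 0 ^+ 2 + p1 * 0 + p0) by field.
by rewrite -e0 -e1 -e2; field.
Qed.

Lemma sub1_delta_ i : D i != 0 -> 1 - delta_ delta i = (1 - (2 * i%:R + 1) * delta) / D i.
Proof.
move=> Di; rewrite /delta_ -/(D i) -{1}(divff Di) -mulrBl; congr (_ / _).
by rewrite /D; ring.
Qed.

(** Origin of [psi]: mu_i + i is the argument of [q] in its definition, so psi(i) is q_i(mu_i) / (1
    - delta_i), the variance formula of a CO variable. *)
Lemma horner_q_mu_ i : D i != 0 -> 1 - (2 * i%:R + 1) * delta != 0 ->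
  (q_ delta beta gamma i).[mu_ mu delta beta i] = psi mu delta beta gamma i%:R * (1 - delta_ delta i).
Proof.
move=> Di Ei; rewrite horner_q_ sub1_delta_// /psi -/q.
have -> : mu_ mu delta beta i + i%:R =
   (- delta * i%:R ^+ 2 + (beta + 1) * i%:R + mu) / (1 - 2 * i%:R * delta).
  by rewrite /mu_; field; exact: Di.
by rewrite -/(D i); field; rewrite Di.
Qed.

(** If the denominator vanished, q_i would have leading coefficient 1, and [co_variance] would force
    q_i(mu_i) = 0. Since w_{i+1} is positive at both j and j + 1, [co_lead_neq1] excludes this. *)
Lemma rising_psi_denom i j : has_moment (2 * i + 2) w -> D i != 0 ->
  0 < wi i.+2 j -> 1 - (2 * i%:R + 1) * delta != 0.
Proof.
move=> wk Di; rewrite rising_weight_gt0 => /andP[wj wj2].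
have H l : j <= l <= j + i.+2%:Z -> 0 < w l by move=> jl; exact: w_conv wj wj2.
have Di0 : 0 < D i.
  apply: (@rising_denom_gt0 i j); first by apply: has_moment_le wk; rewrite ?leq_add2l.
  by rewrite rising_weight_gt0 !H//; lia.
have v0 l : 0 <= 1 * wi i l by rewrite mul1r rising_weight_ge0.
have v2 : has_moment 2 (fun l => 1 * wi i l).
  by apply: has_momentZ; apply: rising_weight_moment; rewrite addnC.
apply/negP => /eqP E0.
have d1 : (q_ delta beta gamma i)`_2 = 1.
  by apply/eqP; rewrite coef_q_2 -subr_eq0 -oppr_eq0 opprB sub1_delta_// E0 mul0r.
have qm : forall l, (q_ delta beta gamma i).[l%:~R] * (1 * wi i l) = (D i)^-1 * wi i.+1 l.
    by move=> l; rewrite horner_q_ mul1r /wi rising_weightS intrD -mulrA.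
have s1 : (size (1 : R)%:P <= 3)%N by apply: leq_trans (size_polyC_leq1 _) _.
have [_ _ [s hs]] := moment_poly v0 v2 s1.
have {}hs : isum (fun l => 1 * wi i l) s.
  apply: eq_isum hs => l.
  by rewrite hornerC; exact: mul1r.
have [V [_ _ ]] := co_variance v0 (rising_co_weights 1 Di) (size_q_ i) v2 hs.
rewrite d1 subrr mul0r => /esym/eqP; rewrite mulf_eq0 => /orP[/eqP qmu|/eqP s0]; last first.
  have := isum_ge j v0 hs; rewrite mul1r s0 leNgt => /negP; apply.
  by rewrite rising_weight_gt0 !H//; lia.
have := co_lead_neq1 (j := j) v0 (rising_co_weights 1 Di) (size_q_ i) v2 qmu.
rewrite d1 eqxx => F; suff : false by []; apply: F.
  by rewrite qm mulr_gt0 ?invr_gt0// rising_weight_gt0 !H//; lia.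
by rewrite qm mulr_gt0 ?invr_gt0// rising_weight_gt0 !H//; lia.
Qed.

(** As q_i w_i is w_{i+1} / D i, the variance sum is also the total mass of the next weight up to
    [D i]. The first conclusion, with normalising [c], yields the variance of X_i; the second, with
    c = 1, the induction for E q^{[i]}(X). *)
Lemma rising_variance i c s : has_moment (2 * i + 2) w -> 0 <= c ->
  D i != 0 -> 1 - (2 * i%:R + 1) * delta != 0 -> isum (fun j => c * wi i j) s ->
  isum (fun j => (j%:~R - mu_ mu delta beta i) ^+ 2 * (c * wi i j))
    (psi mu delta beta gamma i%:R * s) /\
  isum (fun j => c * wi i.+1 j) (D i * psi mu delta beta gamma i%:R * s).
Proof.
move=> wk c0 Di Ei hs.
have v0 l : 0 <= c * wi i l by rewrite mulr_ge0// rising_weight_ge0.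
have v2 : has_moment 2 (fun l => c * wi i l).
  by apply: has_momentZ; apply: rising_weight_moment; rewrite addnC.
have [V [V1 V2]] := co_variance v0 (rising_co_weights c Di) (size_q_ i) v2 hs.
rewrite coef_q_2 horner_q_mu_// mulrAC => e.
have VE : V = psi mu delta beta gamma i%:R * s.
  have d1 : 1 - delta_ delta i != 0 by rewrite sub1_delta_// mulf_neq0// invr_eq0.
  by apply: (mulfI d1); rewrite e mulrC.
split; first by rewrite -VE.
rewrite -mulrA -VE; apply: eq_isum (isumZ (D i) V2) => j.
by rewrite horner_q_ /wi rising_weightS intrD -/(wi i j); field.
Qed.

End Fixed.
End RisingWeights.

(** * From integer-valued random variables to sums *)

Section IntegerValued.
Context d (T : measurableType d) (R : realType) (P : probability T R).
Variable X : {RV P >-> R}.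
Hypothesis X_int : integer_valued X.

Let p := ipmf X.
Let A (j : int) : set T := X @^-1` [set j%:~R].

Let mA j : measurable (A j).
Proof. by apply: measurable_funPTI; exact: measurable_set1. Qed.

Let prA j : P (A j) = (p j)%:E.
Proof. by rewrite /p /ipmf /pmf fineK// fin_num_measure. Qed.

Let A_disj i j t : A i t -> A j t -> i = j.
Proof. by rewrite /A /= => -> /eqP; rewrite eqr_int => /eqP. Qed.

Lemma ipmf_ge0 j : 0 <= p j.
Proof. exact: pmf_ge0. Qed.

Lemma ge0_integral_ipmf (f : R -> R) : measurable_fun setT f -> (forall x, 0 <= f x) ->
  (\int[P]_t (f (X t))%:E = \sum_(n <oo)
     (f n%:Z%:~R * p n%:Z + f (Negz n)%:~R * p (Negz n))%:E)%E.
Proof.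
move=> mf f0.
pose F n := A n%:Z `|` A (Negz n).
have FT : \bigcup_n F n = [set: T].
  apply/seteqP; split=> // t _; have /intrP[j jE] := X_int t.
  by case: j jE => n jE; exists n => //; [left|right].
have mfX D : measurable D -> measurable_fun D (fun t => (f (X t))%:E : \bar R).
  move=> mD; apply: measurable_funTS; apply/measurable_EFinP.
  by apply: measurableT_comp.
have IA j : (\int[P]_(t in A j) (f (X t))%:E = (f j%:~R * p j)%:E)%E.
  rewrite (eq_integral (cst (f j%:~R)%:E)); last by move=> t; rewrite inE => ->.
  rewrite integral_cst// EFinM; congr (_ * _)%E; exact: prA.
rewrite -FT ge0_integral_bigcup//.
- apply: eq_eseriesr => n _; rewrite ge0_integral_setU//.
  + by rewrite !IA.
  + by apply: mfX; exact: measurableU.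
  + by move=> t _; rewrite lee_fin.
  + apply/eqP; rewrite -subset0 => t [h1 h2]; have := A_disj h1 h2.
    by lia.
- by move=> n; exact: measurableU.
- by rewrite FT; exact: mfX.
- by move=> t _; rewrite lee_fin.
- apply/trivIsetP => m n _ _ mn; rewrite -subset0 => t [h1 h2].
  by case: h1 => h1; case: h2 => h2; have := A_disj h1 h2; move/eqP: mn; lia.
Qed.

Lemma ge0_integral_isum (f : R -> R) l : measurable_fun setT f -> (forall x, 0 <= f x) ->
  isum (fun j => f j%:~R * p j) l -> (\int[P]_t (f (X t))%:E = l%:E)%E.
Proof.
move=> mf f0 fl; rewrite ge0_integral_ipmf//; apply/cvg_lim => //.
rewrite (_ : (fun n => _) = EFin \o series (fun n : nat =>
  f n%:Z%:~R * p n%:Z + f (Negz n)%:~R * p (Negz n))).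
  by apply: cvg_EFin; [exact: nearW|exact: fl].
by apply/funext => n /=; rewrite sumEFin.
Qed.

Lemma ge0_integral_lty (f : R -> R) : measurable_fun setT f -> (forall x, 0 <= f x) ->
  (\int[P]_t (f (X t))%:E < +oo)%E -> exists l,
  isum (fun j => f j%:~R * p j) l /\ (\int[P]_t (f (X t))%:E = l%:E)%E.
Proof.
move=> mf f0; rewrite {1}ge0_integral_ipmf// => H.
have : cvgn (series (fun n : nat => f n%:Z%:~R * p n%:Z + f (Negz n)%:~R * p (Negz n))).
  by apply: nnseries_is_cvg => // n; rewrite addr_ge0// mulr_ge0// ipmf_ge0.
by move=> /cvg_ex[l hl]; exists l; split=> //; exact: ge0_integral_isum.
Qed.

Lemma isum_ipmf : isum p 1.
Proof.
have H : (\int[P]_t ((fun=> 1 : R) (X t))%:E = 1)%E.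
  rewrite (eq_integral (cst 1%E))// integral_cst// mul1e; exact: probability_setT.
have m1 : measurable_fun [set: R] (fun=> 1 : R) by exact: measurable_cst.
have [|l [hl]] := ge0_integral_lty m1 (fun=> ler01); first by rewrite H ltry.
rewrite H => -[l1]; move: hl; rewrite -l1.
by apply: eq_isum => j; rewrite mul1r.
Qed.

(** Passes from |x|^k in [abs_moment] to (1 + |x|)^k in [has_moment]: 1 + x is at most 2 or at most
    2 x. *)
Lemma one_add_expr_le (x : R) k : 0 <= x -> (1 + x) ^+ k <= 2 ^+ k * (1 + x ^+ k).
Proof.
move=> x0; have [x1|x1] := leP x 1.
  apply: (@le_trans _ _ (2 ^+ k)).
    by rewrite lerXn2r ?nnegrE ?addr_ge0//; lra.
  by rewrite ler_peMr ?exprn_ge0// lerDl exprn_ge0.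
apply: (@le_trans _ _ ((2 * x) ^+ k)).
  by rewrite lerXn2r ?nnegrE ?addr_ge0 ?mulr_ge0//; lra.
by rewrite exprMn ler_wpM2l ?exprn_ge0// lerDr.
Qed.

Lemma abs_moment_has_moment k : (abs_moment X k < +oo)%E -> has_moment k p.
Proof.
rewrite /abs_moment unlock => H.
have mk : measurable_fun [set: R] (fun x : R => `|x| ^+ k).
  by apply: measurable_funX; exact: normr_measurable.
have k0 (x : R) : 0 <= `|x| ^+ k by rewrite exprn_ge0.
have [l [hl _]] := ge0_integral_lty mk k0 H.
have /cvgP := isumZ (2 ^+ k) (isumD isum_ipmf hl).
have bnd j : (1 + `|j%:~R|) ^+ k * p j <= 2 ^+ k * (p j + `|j%:~R| ^+ k * p j).
  by rewrite -{2}(mul1r (p j)) -mulrDl mulrA ler_wpM2r ?ipmf_ge0// one_add_expr_le.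
have ge0 j : 0 <= (1 + `|j%:~R|) ^+ k * p j.
  by rewrite mulr_ge0 ?ipmf_ge0// exprn_ge0// addr_ge0.
apply: series_le_cvg => n.
- by rewrite addr_ge0.
- by rewrite addr_ge0//; apply: le_trans (bnd _).
- by rewrite lerD.
Qed.

(** Only nonnegative integrands have been turned into sums so far. A dominating [g] is added to [f],
    both nonnegative integrals are evaluated, and that of [g] is subtracted. *)
Lemma integral_horner (f : {poly R}) k l : (size f <= k.+1)%N -> has_moment k p ->
  isum (fun j => f.[j%:~R] * p j) l ->
  P.-integrable setT (fun t => f.[X t]%:E) /\ (\int[P]_t f.[X t]%:E = l%:E)%E.
Proof.
move=> sf pk fl.
have [C C0 fC] := horner_growth sf.
pose g (x : R) := C * (1 + `|x|) ^+ k.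
have g0 x : 0 <= g x by rewrite /g mulr_ge0// exprn_ge0// addr_ge0.
have mg : measurable_fun [set: R] g.
  apply: measurable_funM; first exact: measurable_cst.
  apply: measurable_funX; apply: measurable_funD; first exact: measurable_cst.
  exact: normr_measurable.
have mf : measurable_fun [set: R] (horner f) by exact: measurable_poly.
have mX (h : R -> R) : measurable_fun [set: R] h ->
    measurable_fun [set: T] (fun t => (h (X t))%:E : \bar R).
  by move=> mh; apply/measurable_EFinP; apply: measurableT_comp.
have [lg hg] : exists lg, isum (fun j => g j%:~R * p j) lg.
  move/cvg_ex : (cvg_seriesZ C pk) => [lg hlg]; exists lg.
  rewrite /isum (_ : (fun n : nat => _) = (fun n : nat => C * ((1 + `|n%:Z%:~R|) ^+ k * p n%:Z
                             + (1 + `|(Negz n)%:~R|) ^+ k * p (Negz n))))//.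
  by apply/funext => n; rewrite mulrDr !mulrA.
have Ig := ge0_integral_isum mg g0 hg.
have ig : P.-integrable setT (fun t => (g (X t))%:E).
  apply/integrableP; split; first exact: mX.
  rewrite (eq_integral (fun t => (g (X t))%:E)) ?Ig ?ltry// => t _.
  by rewrite gee0_abs// lee_fin.
have if_ : P.-integrable setT (fun t => f.[X t]%:E).
  apply: le_integrable ig => //; first exact: mX.
  by move=> t _; rewrite !abse_EFin lee_fin (ger0_norm (g0 _)); exact: fC.
split=> //.
have mfg : measurable_fun [set: R] (fun x => f.[x] + g x) by exact: measurable_funD.
have fg0 x : 0 <= f.[x] + g x.
  by have := fC x; rewrite -/(g x) ler_norml -lerBlDr sub0r => /andP[].
have hfg : isum (fun j => (f.[j%:~R] + g j%:~R) * p j) (l + lg).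
  by apply: eq_isum (isumD fl hg) => j; rewrite mulrDl.
have := ge0_integral_isum mfg fg0 hfg.
rewrite (eq_integral (fun t => f.[X t]%:E + (g (X t))%:E)%E)//.
rewrite integralD// Ig EFinD => /(congr1 (fun x => x - lg%:E)%E).
by rewrite !addeK.
Qed.

Lemma expectation_horner (f : {poly R}) k l (F : T -> R) :
  (size f <= k.+1)%N -> has_moment k p ->
  (forall t, F t = f.[X t]) ->
  isum (fun j => f.[j%:~R] * p j) l -> ('E_P[F] = l%:E)%E.
Proof.
move=> sf pk /funext -> fl; rewrite unlock.
by have [_] := integral_horner sf pk fl.
Qed.

(* The density [r o X], normalised, is a new probability on the same space; it is
   written as a series of restrictions of [P] to the level sets of [X]. *)
Lemma reweighting (r : int -> R) (s : R) : (forall j, 0 <= r j) ->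
  isum (fun j => r j * p j) s -> 0 < s ->
  exists (P' : probability T R) (Y : {RV P' >-> R}),
    integer_valued Y /\ proportional (ipmf Y) (fun j => r j * p j).
Proof.
move=> r0 hs s0.
pose mm j : {measure set T -> \bar R} := mscale (NngNum (r0 j)) (mrestr P (mA j)).
pose M : {measure set T -> \bar R} := mseries (fun n : nat => measure_add (mm n%:Z) (mm (Negz n))) 0.
have ME B : M B = (\sum_(n <oo) ((r n%:Z)%:E * P (B `&` A n%:Z) +
    (r (Negz n))%:E * P (B `&` A (Negz n))))%E.
  by rewrite /M /= /mseries; apply: eq_eseriesr => n _; exact: measure_addE.
have MT : M setT = s%:E.
  rewrite ME; apply/cvg_lim => //.
  rewrite (_ : (fun n => _) = EFin \o series (fun n : nat =>
    r n%:Z * p n%:Z + r (Negz n) * p (Negz n))).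
    by apply: cvg_EFin; [exact: nearW|exact: hs].
  apply/funext => n /=; rewrite -sumEFin; apply: eq_bigr => i _.
  by rewrite !setTI !prA.
have AA i j : A i `&` A j = if i == j then A i else set0.
  case: eqP => [->|ij]; first by rewrite setIid.
  by apply/seteqP; split=> // t [h1 h2]; apply: ij; exact: A_disj h1 h2.
have MA j : M (A j) = (r j * p j)%:E.
  pose n0 := match j with Posz n => n | Negz n => n end.
  rewrite ME (@nneseriesD1 _ _ n0)//; last first.
    by move=> n _; rewrite adde_ge0// mule_ge0 ?lee_fin//.
  rewrite eseries0 ?adde0.
    rewrite !AA /n0; clear n0; case: j => n; rewrite eqxx prA.
      by rewrite measure0 mule0 adde0.
    by rewrite measure0 mule0 add0e.
  move=> n _ /= nn0; rewrite !AA.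
  do 2 (case: eqP => [jn|_]; first by move: nn0; rewrite /n0 jn eqxx).
  by rewrite !measure0 !mule0 adde0.
(* The variable is still X, only the measure changes. The fallback [P] of [mnormalize] is not
   reached, since the mass [s] is finite and positive. *)
exists (mnormalize M P), X; split=> //; exists s^-1 => j.
rewrite /ipmf /pmf /= /mnormalize MT.
rewrite orbF eqe gt_eqF//= -/(A j) MA.
by rewrite -EFinM /= mulrC.
Qed.

End IntegerValued.

(** With m = i + 1 and m = i + 2 the second alternative is precisely the premise in [mu_q_defined]
    and in [psi_defined]; with m = n it contradicts the lower bound on the support. *)
Lemma int_interval_card (S : set int) (alpha omega : \bar int) (m : nat) :
  S = [set j : int | (alpha <= j%:E <= omega)%E] ->
  (exists j, S j /\ S (j + m%:Z)) \/ S #<= `I_m.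
Proof.
move=> ->; set S' := [set j | _].
have [->|/set0P[j0 /= /andP[aj jw]]] := eqVneq S' set0.
  by right; exact: card_ge0.
case: alpha aj @S' => [a| |]//; case: omega jw => [w| |]//; rewrite ?lee_fin => wj aj S'.
- have [aw|aw] := leP (a + m%:Z) w.
    by left; exists a; rewrite /S' /= !lee_fin; lia.
  right; apply: (@card_le_trans _ _ _ ((fun n : nat => a + n%:Z) @` `I_m)).
    apply: subset_card_le => j; rewrite /S' /= !lee_fin => /andP[h1 h2].
    by exists (absz (j - a)); rewrite ?/=; lia.
  exact: card_image_le.
- by left; exists j0; rewrite /S' /= !lee_fin !leey; lia.
- by left; exists (j0 - m%:Z); rewrite /S' /= !lee_fin !leNye; lia.
- by left; exists j0; rewrite /S' /= !leNye !leey.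
Qed.

(** * Factorial moments *)

Section FactorialPolynomials.
Variable R : realType.
Implicit Types (x : R).

Lemma horner_XaddC (c x : R) : ('X + c%:P).[x] = x + c.
Proof. by rewrite !hornerE. Qed.

Lemma desc_factS x r : desc_fact x r.+1 = desc_fact x r * (x - r%:R).
Proof. by rewrite /desc_fact big_ord_recr. Qed.

Lemma desc_factSl x r : desc_fact x r.+1 = x * desc_fact (x - 1) r.
Proof.
rewrite /desc_fact big_ord_recl subr0; congr (_ * _); apply: eq_bigr => l _.
by rewrite /= /bump /= natrD opprD addrA.
Qed.

Lemma asc_factS x r : asc_fact x r.+1 = asc_fact x r * (x + r%:R).
Proof. by rewrite /asc_fact big_ord_recr. Qed.

Lemma asc_factSl x r : asc_fact x r.+1 = x * asc_fact (x + 1) r.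
Proof.
rewrite /asc_fact big_ord_recl addr0; congr (_ * _); apply: eq_bigr => l _.
by rewrite /= /bump /= natrD addrA.
Qed.

(** Induction on [x+1]_{r+1} = (r+1) [x+1]_r + [x]_{r+1}. This expansion is the source of the full
    sum in the ascending recurrence of (f). *)
Lemma asc_fact_shift x r :
  asc_fact (x + 1) r = r`!%:R * \sum_(k < r.+1) asc_fact x k / k`!%:R.
Proof.
elim: r => [|r IH].
  by rewrite big_ord1 fact0 divr1 mul1r /asc_fact !big_ord0.
rewrite big_ord_recr /= mulrDr factS natrM -mulrA -IH mulrCA divff ?mulr1.
  by rewrite asc_factS asc_factSl -natr1; ring.
by rewrite mulf_neq0// pnatr_eq0// -lt0n fact_gt0.
Qed.

(** Induction on (x-1)_{r+1} = (x)_{r+1} - (r+1) (x-1)_r, hence the alternating signs. *)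
Lemma desc_fact_shift x r : desc_fact (x - 1) r =
  r`!%:R * \sum_(k < r.+1) (-1) ^+ (r + k) * (desc_fact x k / k`!%:R).
Proof.
elim: r => [|r IH].
  by rewrite big_ord1 fact0 divr1 expr0 !mul1r /desc_fact !big_ord0.
rewrite big_ord_recr /= addnn -signr_odd odd_double expr0 mul1r mulrDr.
rewrite [X in _ = _ + X]mulrCA divff ?mulr1; last first.
  by rewrite pnatr_eq0 -lt0n fact_gt0.
under eq_bigr do rewrite addSn exprS mulN1r mulNr.
rewrite sumrN mulrN factS natrM -mulrA -IH desc_factS desc_factSl -natr1; ring.
Qed.

Definition desc_poly r : {poly R} := \prod_(l < r) ('X - l%:R%:P).
Definition asc_poly r : {poly R} := \prod_(l < r) ('X + l%:R%:P).

Lemma horner_desc_poly r x : (desc_poly r).[x] = desc_fact x r.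
Proof. by rewrite horner_prod; apply: eq_bigr => l _; rewrite !hornerE. Qed.

Lemma horner_asc_poly r x : (asc_poly r).[x] = asc_fact x r.
Proof. by rewrite horner_prod; apply: eq_bigr => l _; rewrite !hornerE. Qed.

Lemma size_desc_poly r : (size (desc_poly r) <= r.+1)%N.
Proof.
rewrite /desc_poly; elim: r => [|r IH]; first by rewrite big_ord0 size_poly1.
rewrite big_ord_recr /= (_ : r.+2 = (r.+1 + 2).-1)%N; last by lia.
by apply: size_mul_leq; rewrite ?size_XsubC.
Qed.

Lemma size_asc_poly r : (size (asc_poly r) <= r.+1)%N.
Proof.
rewrite /asc_poly; elim: r => [|r IH]; first by rewrite big_ord0 size_poly1.
rewrite big_ord_recr /= (_ : r.+2 = (r.+1 + 2).-1)%N; last by lia.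
by apply: size_mul_leq; rewrite ?size_XaddC.
Qed.

End FactorialPolynomials.

(** * The CO condition against its differenced form, and the four moment recurrences *)

Section CumulativeOrdVariables.
Context d (T : measurableType d) (R : realType) (P : probability T R).
Variable X : {RV P >-> R}.

Lemma CO_co_weights mu q : CO X mu q -> co_weights (ipmf X) mu q.
Proof.
move=> [_ _ _ _ H] j.
have := H j; rewrite -cvg_shiftS => Hj.
pose u (m : nat) := (mu - (j - m%:Z)%:~R) * ipmf X (j - m%:Z).
pose v (m : nat) := (mu - (j - 1 - m%:Z)%:~R) * ipmf X (j - 1 - m%:Z).
have E : (fun n => series u n.+1) = (fun n => u 0%N + series v n).
  apply/funext => n; rewrite /series /= big_nat_recl//; congr (_ + _).
  apply: eq_bigr => i _; rewrite /u /v.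
  by rewrite (_ : j - i.+1%:Z = j - 1 - i%:Z)//; lia.
have H2 : (fun n => series u n.+1) @ \oo -->
    u 0%N + q.[(j - 1)%:~R] * ipmf X (j - 1).
  by rewrite E; apply: cvgD; [exact: cvg_cst|exact: H].
have -> : q.[j%:~R] * ipmf X j = u 0%N + q.[(j - 1)%:~R] * ipmf X (j - 1).
  exact: (cvg_unique _ Hj H2).
by rewrite addrK /u subr0.
Qed.

(** The mean is not assumed: telescoping over all integers gives E(mu - X) = 0. The sum up to j
    telescopes to q p at j minus its limit 0 at minus infinity. *)
Lemma co_weights_CO mu (q : {poly R}) : integer_valued X -> (size q <= 3)%N ->
  co_weights (ipmf X) mu q -> has_moment 1 (ipmf X) -> CO X mu q.
Proof.
move=> Xint sq rec m1.
have p0 := ipmf_ge0 X.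
have S0 := isum_telescope p0 m1 (sub_X_size mu) sq (co_rec_poly rec).
have SX : isum (fun j => ('X : {poly R}).[j%:~R] * ipmf X j) mu.
  have := isumD (isumZ mu (isum_ipmf Xint)) (isumZ (-1) S0).
  rewrite mulr1 mulr0 addr0; apply: eq_isum => j.
  by rewrite !hornerE /=; ring.
have sX : (size ('X : {poly R}) <= 2)%N by rewrite size_polyX.
split=> //.
- have [] := integral_horner Xint sX m1 SX.
  by under eq_fun do rewrite hornerX.
- by apply: (expectation_horner Xint sX m1 _ SX) => t; rewrite hornerX.
move=> j; pose h j := q.[j%:~R] * ipmf X j.
have hN := boundary_neg p0 m1 (sub_X_size mu) sq (co_rec_poly rec).
have E : series (fun m : nat => (mu - (j - m%:Z)%:~R) * ipmf X (j - m%:Z)) =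
   (fun m : nat => h j - h (j - m%:Z)).
  apply/funext; elim=> [|m IH]; first by rewrite /series /= big_geq// subr0 subrr.
  rewrite seriesSr IH -rec (_ : j - m.+1%:Z = j - m%:Z - 1); last by lia.
  by rewrite /h; ring.
rewrite E -[X in _ --> X]subr0; apply: cvgB; first exact: cvg_cst.
apply/cvgrPdist_lt => e e0; move/cvgrPdist_lt : hN => /(_ e e0)[N _ HN].
(* Far enough for j - m to be [Negz] of an index at least [N]. *)
exists (N + `|j| + 1)%N => // m /= Nm.
have -> : j - m%:Z = Negz (absz (m%:Z - j - 1)%R) by lia.
by apply: HN => /=; lia.
Qed.

Hypothesis X_int : integer_valued X.
Variable k : nat.
Hypothesis Xk : has_moment k (ipmf X).

Lemma isum_desc_moment r : (r <= k)%N ->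
  isum (fun j => desc_fact j%:~R r * ipmf X j) (desc_moment X r).
Proof.
move=> rk; have sr : (size (desc_poly R r) <= k.+1)%N.
  by apply: leq_trans (size_desc_poly _ _) _.
have [_ _ [l hl]] := moment_poly (ipmf_ge0 X) Xk sr.
rewrite /desc_moment (expectation_horner X_int sr Xk _ hl) /=.
  by apply: eq_isum hl => j; rewrite horner_desc_poly.
by move=> t; rewrite horner_desc_poly.
Qed.

Lemma isum_asc_moment r : (r <= k)%N ->
  isum (fun j => asc_fact j%:~R r * ipmf X j) (asc_moment X r).
Proof.
move=> rk; have sr : (size (asc_poly R r) <= k.+1)%N.
  by apply: leq_trans (size_asc_poly _ _) _.
have [_ _ [l hl]] := moment_poly (ipmf_ge0 X) Xk sr.
rewrite /asc_moment (expectation_horner X_int sr Xk _ hl) /=.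
  by apply: eq_isum hl => j; rewrite horner_asc_poly.
by move=> t; rewrite horner_asc_poly.
Qed.

Variables (mu delta beta gamma : R).
Hypothesis hX : CO X mu (quad delta beta gamma).

Let p0 := ipmf_ge0 X.
Let rec := CO_co_weights hX.
Let sq := size_quad delta beta gamma.

Let stein' r (g dg : {poly R}) : (r < k)%N -> (size g <= r.+1)%N -> (size dg <= r)%N ->
  (forall x, g.[x + 1] - g.[x] = dg.[x]) ->
  isum (fun j => ((quad delta beta gamma).[j%:~R] * dg.[j%:~R] -
    (j%:~R - mu) * g.[j%:~R]) * ipmf X j) 0.
Proof. by move=> rk; apply: stein => //; exact: has_moment_le Xk. Qed.

Let size_natmul r (g : {poly R}) m : (size g <= m)%N -> (size (r%:R%:P * g)%R <= m)%N.
Proof. by move=> gm; apply: (size_mul_leq (size_polyC_leq1 _) gm). Qed.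

Lemma desc_moment_rec r : (r.+1 < k)%N ->
  (1 - r.+1%:R * delta) * desc_moment X r.+2 =
    (mu + r.+1%:R * (beta - 1 + (2 * r.+1%:R - 1) * delta)) * desc_moment X r.+1 +
    r.+1%:R * (gamma + (r.+1%:R - 1) * (beta + (r.+1%:R - 1) * delta)) *
      desc_moment X r.
Proof.
move=> rk.
have S0 := @stein' r.+1 (desc_poly R r.+1) (r.+1%:R%:P * desc_poly R r) rk
  (size_desc_poly _ _) (size_natmul _ (size_desc_poly _ _)).
set c1 := 1 - _; set c2 := mu + _; set c3 := r.+1%:R * (gamma + _).
have S1 := isumD (isumZ c2 (isum_desc_moment (ltnW rk)))
  (isumD (isumZ c3 (isum_desc_moment (ltnW (ltnW rk))))
    (isumZ (- c1) (isum_desc_moment rk))).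
apply/eqP; rewrite -subr_eq0 -oppr_eq0; apply/eqP.
rewrite [LHS](_ : _ = c2 * desc_moment X r.+1 + (c3 * desc_moment X r +
   - c1 * desc_moment X r.+2)); last by ring.
apply: isum_unique S1 _; apply: eq_isum (S0 _) => [j|x].
  rewrite hornerM hornerC !horner_desc_poly horner_quad !desc_factS /c1 /c2 /c3 -!natr1.
  ring.
rewrite hornerM hornerC !horner_desc_poly desc_factSl addrK desc_factS -natr1; ring.
Qed.

(** The factor x - 1 makes the forward difference of g equal to (r+1) [x]_r, with no shifted
    factorial, so only three consecutive moments occur. *)
Lemma asc_moment_rec r : (r.+1 < k)%N ->
  (1 - r.+1%:R * delta) * asc_moment X r.+2 =
    (mu + r.+1%:R * (beta + 2 - (2 * r.+1%:R - 1) * delta)) * asc_moment X r.+1 +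
    r.+1%:R * (gamma - mu - (r.+1%:R - 1) * (beta + 1 - (r.+1%:R - 1) * delta)) *
      asc_moment X r.
Proof.
move=> rk.
have sg : (size (('X - 1%:P) * asc_poly R r)%R <= r.+2)%N.
  by apply: (@size_mul_leq _ _ _ 2 r.+1); rewrite ?size_XsubC ?size_asc_poly.
have S0 := @stein' r.+1 (('X - 1%:P) * asc_poly R r) (r.+1%:R%:P * asc_poly R r) rk
  sg (size_natmul _ (size_asc_poly _ _)).
set c1 := 1 - _; set c2 := mu + _; set c3 := r.+1%:R * (gamma - _ - _).
have S1 := isumD (isumZ c2 (isum_asc_moment (ltnW rk)))
  (isumD (isumZ c3 (isum_asc_moment (ltnW (ltnW rk))))
    (isumZ (- c1) (isum_asc_moment rk))).
apply/eqP; rewrite -subr_eq0 -oppr_eq0; apply/eqP.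
rewrite [LHS](_ : _ = c2 * asc_moment X r.+1 + (c3 * asc_moment X r +
   - c1 * asc_moment X r.+2)); last by ring.
apply: isum_unique S1 _; apply: eq_isum (S0 _) => [j|x].
  rewrite !hornerM hornerXsubC hornerC !horner_asc_poly horner_quad !asc_factS /c1 /c2 /c3 -!natr1.
  ring.
rewrite !hornerM !hornerXsubC hornerC !horner_asc_poly addrK -asc_factSl asc_factS -natr1; ring.
Qed.

(** Here the difference is (r+1) [x+1]_r. Multiplying by x turns it into [x]_{r+1}, so only the
    constant term gamma of [q] keeps the shifted factorial, which is then expanded. *)
Lemma asc_moment_sum r : (r.+1 < k)%N ->
  (1 - r.+1%:R * delta) * asc_moment X r.+2 =
    (mu + r.+1%:R * (beta - r.+1%:R * delta + 1)) * asc_moment X r.+1 +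
    gamma * r.+1`!%:R * (\sum_(l < r.+1) asc_moment X l / l`!%:R).
Proof.
move=> rk.
have sdg : (size (r.+1%:R%:P * (asc_poly R r \Po ('X + 1%:P)))%R <= r.+1)%N.
  by apply: size_natmul; rewrite size_shift_poly size_asc_poly.
have S0 := @stein' r.+1 (asc_poly R r.+1) _ rk (size_asc_poly _ _) sdg.
set c1 := 1 - _; set c2 := mu + _; set c3 := gamma * _.
have S2 : isum (fun j => \sum_(l < r.+1) asc_fact j%:~R l / l`!%:R * ipmf X j)
    (\sum_(l < r.+1) asc_moment X l / l`!%:R).
  apply: isum_sum => l.
  have lk : (l <= k)%N by have := ltn_ord l; lia.
  rewrite mulrC; apply: eq_isum (isumZ l`!%:R^-1 (isum_asc_moment lk)) => j.
  by ring.
have S1 := isumD (isumZ c2 (isum_asc_moment (ltnW rk)))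
  (isumD (isumZ c3 S2) (isumZ (- c1) (isum_asc_moment rk))).
apply/eqP; rewrite -subr_eq0 -oppr_eq0; apply/eqP.
set M := \sum_(l < r.+1) asc_moment X l / _ in S1 *.
rewrite [LHS](_ : _ = c2 * asc_moment X r.+1 + (c3 * M +
   - c1 * asc_moment X r.+2)); last by ring.
apply: isum_unique S1 _; apply: eq_isum (S0 _) => [j|x].
  rewrite hornerM hornerC horner_comp horner_XaddC !horner_asc_poly horner_quad.
  rewrite -mulr_suml [c3 * _](_ : _ = gamma * r.+1%:R * asc_fact (j%:~R + 1) r * ipmf X j).
    rewrite (asc_factS _ r.+1) !(asc_factSl _ r) /c1 /c2 -!natr1; ring.
  by rewrite asc_fact_shift /c3 factS natrM; ring.
rewrite hornerM hornerC horner_comp horner_XaddC !horner_asc_poly.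
by rewrite asc_factS asc_factSl -natr1; ring.
Qed.

(** The difference is (r+1) (x-1)_r. Besides gamma, the term mu (x-1)_{r+1} leaves a multiple of
    (x-1)_r behind, hence the coefficient gamma - mu. *)
Lemma desc_moment_sum r : (r.+1 < k)%N ->
  (1 - r.+1%:R * delta) * desc_moment X r.+2 =
    (delta * r.+1%:R ^+ 2 + beta * r.+1%:R + mu) * desc_moment X r.+1 +
    (gamma - mu) * r.+1`!%:R *
      (\sum_(l < r.+1) (-1) ^+ (r.+1 + l + 1) * (desc_moment X l / l`!%:R)).
Proof.
move=> rk.
have sg : (size (desc_poly R r.+1 \Po ('X - 1%:P)) <= r.+2)%N.
  by rewrite -polyCN size_shift_poly size_desc_poly.
have sdg : (size (r.+1%:R%:P * (desc_poly R r \Po ('X - 1%:P)))%R <= r.+1)%N.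
  by apply: size_natmul; rewrite -polyCN size_shift_poly size_desc_poly.
have S0 := @stein' r.+1 _ _ rk sg sdg.
set c1 := 1 - _; set c2 := _ + mu; set c3 := (gamma - mu) * _.
have S2 : isum (fun j => \sum_(l < r.+1)
      (-1) ^+ (r + l) * (desc_fact j%:~R l / l`!%:R) * ipmf X j)
    (\sum_(l < r.+1) (-1) ^+ (r.+1 + l + 1) * (desc_moment X l / l`!%:R)).
  apply: isum_sum => l.
  have lk : (l <= k)%N by have := ltn_ord l; lia.
  rewrite (_ : r.+1 + l + 1 = (r + l).+2)%N; last by lia.
  rewrite !exprS mulrA mulrNN !mul1r mulrA mulrAC.
  apply: eq_isum (isumZ ((-1) ^+ (r + l) / l`!%:R) (isum_desc_moment lk)) => j.
  by ring.
have S1 := isumD (isumZ c2 (isum_desc_moment (ltnW rk)))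
  (isumD (isumZ c3 S2) (isumZ (- c1) (isum_desc_moment rk))).
apply/eqP; rewrite -subr_eq0 -oppr_eq0; apply/eqP.
set M := \sum_(l < r.+1) _ * (desc_moment X l / _) in S1 *.
rewrite [LHS](_ : _ = c2 * desc_moment X r.+1 + (c3 * M +
   - c1 * desc_moment X r.+2)); last by ring.
apply: isum_unique S1 _; apply: eq_isum (S0 _) => [j|x].
  rewrite hornerM hornerC !horner_comp !hornerXsubC !horner_desc_poly horner_quad.
  rewrite -mulr_suml [c3 * _](_ : _ =
    (gamma - mu) * r.+1%:R * desc_fact (j%:~R - 1) r * ipmf X j).
    rewrite (desc_factS _ r.+1) (desc_factS (j%:~R - 1)) !(desc_factSl _ r).
    by rewrite /c1 /c2 -!natr1; ring.
  by rewrite desc_fact_shift /c3 factS natrM; ring.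
rewrite hornerM hornerC !horner_comp !hornerXsubC !horner_desc_poly addrK.
by rewrite (desc_factS (x - 1)) desc_factSl -natr1; ring.
Qed.

End CumulativeOrdVariables.

(** * The random variables X_i *)

Section RisingVariables.
Context d (T : measurableType d) (R : realType) (P : probability T R).
Variables (X : {RV P >-> R}) (mu delta beta gamma : R) (alpha omega : \bar int) (n : nat).
Hypothesis hX : CO X mu (quad delta beta gamma).
Hypothesis hS : isupport X = [set j : int | (alpha <= j%:E <= omega)%E].
Hypothesis hn : `I_n.+1 #<= isupport X.
Hypothesis hmom : (abs_moment X (2 * n + 1) < +oo)%E.

Let q := quad delta beta gamma.
Let p := ipmf X.
Let p0 := ipmf_ge0 X.
Let X_int : integer_valued X. Proof. by case: hX. Qed.
Let rec : co_weights p mu q := CO_co_weights hX.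
Let pk : has_moment (2 * n + 1) p := abs_moment_has_moment X_int hmom.

Lemma CO_moment_le k : (k <= 2 * n + 1)%N -> has_moment k p.
Proof. by move=> kn; exact: has_moment_le pk. Qed.

Let p1 : has_moment 1 p.
Proof. by apply: CO_moment_le; lia. Qed.

Lemma isupportP j : (0 < p j) = (alpha <= j%:E <= omega)%E.
Proof.
have : isupport X j <-> [set j : int | (alpha <= j%:E <= omega)%E] j by rewrite hS.
by move=> [h1 h2]; apply/idP/idP.
Qed.

Lemma isupport_convex i j k : i <= j <= k -> 0 < p i -> 0 < p k -> 0 < p j.
Proof.
move=> /andP[ij jk]; rewrite !isupportP => /andP[ai _] /andP[_ ko].
apply/andP; split; first by apply: le_trans ai _; rewrite lee_fin.
by apply: le_trans ko; rewrite lee_fin.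
Qed.
Let conv := isupport_convex.

Let wi := rising_weight q p.
Let D i := 1 - 2 * i%:R * delta.

Let wi_gt0 i j : (0 < wi i j) = (0 < p j) && (0 < p (j + i%:Z)).
Proof. exact: (rising_weight_gt0 p0 rec p1 conv). Qed.

Let wi_ge0 i j : 0 <= wi i j.
Proof. exact: (rising_weight_ge0 p0 rec p1 conv). Qed.

Lemma rising_weight_nontrivial i : (i <= n)%N -> exists j, 0 < wi i j.
Proof.
move=> ni; have [[j [pj pjn]]|Sn] := int_interval_card n hS.
  exists j; rewrite wi_gt0; apply/andP; split; first exact: pj.
  by apply: conv pj pjn; lia.
by have := card_le_trans hn Sn; rewrite card_le_II ltnn.
Qed.

Lemma rising_denom_neq0 i : (i <= n)%N -> mu_q_defined (isupport X) delta i -> D i != 0.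
Proof.
move=> ni; have [[j [pj pji]] _|Si] := int_interval_card i.+1 hS; last exact.
apply: lt0r_neq0; apply: (rising_denom_gt0 (j := j) p0 rec p1 conv).
  by apply: CO_moment_le; lia.
by rewrite -/wi wi_gt0; apply/andP.
Qed.

Lemma rising_denom_gt0_lt i : (i < n)%N -> 0 < D i.
Proof.
move=> ni; have [j wj] := rising_weight_nontrivial ni.
apply: (rising_denom_gt0 p0 rec p1 conv) wj.
by apply: CO_moment_le; lia.
Qed.

Lemma psi_denom_neq0 i : (i <= n)%N -> psi_defined (isupport X) delta i ->
  has_moment (2 * i + 2) p -> D i != 0 /\ 1 - (2 * i%:R + 1) * delta != 0.
Proof.
move=> ni [Di Ei] m2; have D0 := rising_denom_neq0 ni Di; split=> //.
have [[j [pj pji]]|Si] := int_interval_card i.+2 hS; last exact: Ei.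
apply: (rising_psi_denom (j := j) p0 rec p1 conv m2 D0).
by rewrite -/wi wi_gt0; apply/andP.
Qed.

Lemma isum_rising_weight i : (i <= n)%N -> exists2 s, 0 < s & isum (wi i) s.
Proof.
move=> ni; have si : (size (rising_poly q i) <= (2 * n + 1).+1)%N.
  by apply: leq_trans (size_rising_poly i (size_quad _ _ _)) _; lia.
have [_ _ [s hs]] := moment_poly p0 pk si.
have {}hs : isum (wi i) s.
  by apply: eq_isum hs => j; rewrite -rising_weight_poly.
have [j wj] := rising_weight_nontrivial ni.
by exists s => //; apply: lt_le_trans wj (isum_ge j (wi_ge0 i) hs).
Qed.

Lemma rising_variable_exists i : (i <= n)%N ->
  exists (P' : probability T R) (Y : {RV P' >-> R}),
    integer_valued Y /\ proportional (ipmf Y) (wi i).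
Proof.
move=> ni; have [s s0 hs] := isum_rising_weight ni.
(* A density must be nonnegative everywhere; the absolute value changes q^{[i]} only where p
   vanishes or q^{[i]} p does. *)
pose r j := `|rising (horner q) i j%:~R|.
have rE : (fun j => r j * p j) = wi i.
  apply/funext => j; rewrite -[RHS](ger0_norm (wi_ge0 i j)) /r.
  by rewrite /wi /rising_weight normrM (ger0_norm (p0 j)).
have := @reweighting _ _ _ _ _ X_int r s.
rewrite -/p rE; apply=> // j; exact: normr_ge0.
Qed.

(** Each step multiplies the mass by D i psi(i), and [D i] is the factor 1 - i (2 delta) of the
    product with parameter 2 delta. *)
Lemma isum_rising_weight_psi i : (i <= n)%N ->
  (forall l, (l < i)%N -> psi_defined (isupport X) delta l) ->
  isum (wi i) (rising (psi mu delta beta gamma) i 0 * Pi_prod (2 * delta) i 0).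
Proof.
elim: i => [|i IH] ni hi.
  rewrite /rising big_ord0 /Pi_prod big_geq// mulr1.
  by apply: eq_isum (isum_ipmf X_int) => j; rewrite /wi rising_weight0.
have Si := IH (ltnW ni) (fun l li => hi l (ltnW li)).
have mi : has_moment (2 * i + 2) p by apply: CO_moment_le; lia.
have [Di Ei] := psi_denom_neq0 (ltnW ni) (hi i (ltnSn i)) mi.
have S1 : isum (fun j => 1 * wi i j)
    (rising (psi mu delta beta gamma) i 0 * Pi_prod (2 * delta) i 0).
  by apply: eq_isum Si => j; rewrite mul1r.
have [_ S2] := rising_variance p0 rec p1 conv mi ler01 Di Ei S1.
rewrite risingS_r add0r /Pi_prod addn0 big_nat_recr//=.
rewrite [X in isum _ X](_ : _ = D i * psi mu delta beta gamma i%:R *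
  (rising (psi mu delta beta gamma) i 0 * Pi_prod (2 * delta) i 0)).
  by apply: eq_isum S2 => j; rewrite mul1r.
by rewrite /Pi_prod addn0 /D; ring.
Qed.

Section Variable_i.
Context d' (T' : measurableType d') (P' : probability T' R).
Variables (Y : {RV P' >-> R}) (i : nat).
Hypotheses (ni : (i <= n)%N) (Y_int : integer_valued Y).
Hypothesis Yprop : proportional (ipmf Y) (wi i).

(** [proportional] says nothing about the sign of the constant; it is positive because c s = 1 with
    s the positive mass of the weight. *)
Lemma rising_variable_pmf : exists2 c, 0 < c & ipmf Y = (fun j => c * wi i j).
Proof.
have [c hc] := Yprop; have [s s0 hs] := isum_rising_weight ni.
exists c; last by apply/funext.
have e1 : c * s = 1.
  apply: isum_unique (isumZ c hs) _; apply: eq_isum (isum_ipmf Y_int) => j.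
  by rewrite hc.
by rewrite -(pmulr_lgt0 c s0) e1.
Qed.

Lemma rising_variable_support :
  isupport Y = [set j : int | (alpha <= j%:E <= omega - i%:Z%:E)%E].
Proof.
have [c c0 hc] := rising_variable_pmf.
rewrite /isupport hc; apply/seteqP.
have H j : (0 < c * wi i j) = (alpha <= j%:E <= omega - i%:Z%:E)%E.
  rewrite pmulr_rgt0// wi_gt0 !isupportP.
  case: alpha => [a| |]; case: omega => [w| |];
    rewrite -?EFinB ?lee_fin ?leNye ?leey ?leeNy_eq ?leye_eq ?andbF ?andbT//=; lia.
by split=> j /=; rewrite H.
Qed.

Lemma rising_variable_CO : D i != 0 ->
  CO Y (mu_ mu delta beta i) (q_ delta beta gamma i).
Proof.
move=> Di; have [c c0 hc] := rising_variable_pmf.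
apply: co_weights_CO => //; first exact: size_q_.
  by rewrite hc; exact: rising_co_weights.
rewrite hc; apply: has_momentZ; apply: (rising_weight_moment p0 rec p1 conv).
by apply: CO_moment_le; lia.
Qed.

Lemma rising_variable_variance : psi_defined (isupport X) delta i ->
  has_moment (2 * i + 2) p ->
  ('V_P'[Y] = (psi mu delta beta gamma i%:R)%:E)%E.
Proof.
move=> hpsi mi; have [Di Ei] := psi_denom_neq0 ni hpsi mi.
have [c c0 hc] := rising_variable_pmf.
have hE : ('E_P'[Y] = (mu_ mu delta beta i)%:E)%E by case: (rising_variable_CO Di).
have S1 : isum (fun j => c * wi i j) 1 by rewrite -hc; exact: isum_ipmf.
have [S2 _] := rising_variance p0 rec p1 conv mi (ltW c0) Di Ei S1.
have m2 : has_moment 2 (ipmf Y).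
  rewrite hc; apply: has_momentZ; apply: (rising_weight_moment p0 rec p1 conv).
  by rewrite addnC.
have s2 : (size (('X - (mu_ mu delta beta i)%:P) ^+ 2) <= 3)%N by rewrite size_exp_XsubC.
rewrite /variance unlock hE /=.
apply: (expectation_horner Y_int s2 m2) => [t|].
  by rewrite !hornerE /= expr2.
by move: S2; rewrite mulr1; apply: eq_isum => j; rewrite hc !hornerE.
Qed.

End Variable_i.

End RisingVariables.

Theorem proposition6p2 (R : realType) (d : measure_display)
    (T : measurableType d) (P : probability T R) (X : {RV P >-> R})
    (mu delta beta gamma : R) (alpha omega : \bar int) (n : nat)
    (hX : CO X mu (quad delta beta gamma))
    (hS : isupport X = [set j : int | (alpha <= j%:E <= omega)%E])
    (hn : `I_n.+1 #<= isupport X)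
    (hmom : (abs_moment X (2 * n + 1) < +oo)%E) :
  let S := isupport X in
  let q := quad delta beta gamma in
  let weight (i : nat) (j : int) := rising (horner q) i j%:~R * ipmf X j in
  (* the random variables X_i exist *)
  (forall i, (i <= n)%N ->
     exists (d' : measure_display) (T' : measurableType d')
            (P' : probability T' R) (Y : {RV P' >-> R}),
       integer_valued Y /\ proportional (ipmf Y) (weight i)) /\
  (forall (d' : nat -> measure_display)
          (T' : forall i, measurableType (d' i))
          (P' : forall i, probability (T' i) R)
          (Y : forall i, {RV (P' i) >-> R}),
     (forall i, (i <= n)%N ->
        integer_valued (Y i) /\ proportional (ipmf (Y i)) (weight i)) ->
     [/\ ipmf (Y 0%N) =1 ipmf X,
         (forall i, (1 <= i <= n)%N ->
            proportional (ipmf (Y i))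
              (fun j => (q_ delta beta gamma i.-1).[j%:~R] *
                        ipmf (Y i.-1) j)),
         (* (a) *)
         (forall i, (i <= n)%N ->
            isupport (Y i) =
            [set j : int | (alpha <= j%:E <= omega - i%:Z%:E)%E]),
         (* (b) *)
         (forall i, (i <= n)%N -> mu_q_defined S delta i ->
            CO (Y i) (mu_ mu delta beta i) (q_ delta beta gamma i) /\
            (q_ delta beta gamma i)`_2 = delta_ delta i)
       & (* (c) *)
         (forall i, (i <= n)%N -> psi_defined S delta i ->
            (i = n -> (abs_moment X (2 * n + 2) < +oo)%E) ->
            ('V_(P' i)[Y i])%E = (psi mu delta beta gamma i%:R)%:E)]) /\
  (* (d) *)
  (forall i, (i <= n)%N ->
     (forall l, (l < i)%N -> psi_defined S delta l) ->
     ('E_P[fun t => rising (horner q) i (X t)])%E =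
     (rising (psi mu delta beta gamma) i 0 * Pi_prod (2 * delta) i 0)%:E) /\
  (* (e) *)
  [/\ desc_moment X 0 = 1, asc_moment X 0 = 1,
      desc_moment X 1 = mu, asc_moment X 1 = mu
    & forall r, (1 <= r <= 2 * n)%N ->
      (1 - r%:R * delta) * desc_moment X r.+1 =
        (mu + r%:R * (beta - 1 + (2 * r%:R - 1) * delta)) * desc_moment X r +
        r%:R * (gamma + (r%:R - 1) * (beta + (r%:R - 1) * delta)) *
          desc_moment X r.-1 /\
      (1 - r%:R * delta) * asc_moment X r.+1 =
        (mu + r%:R * (beta + 2 - (2 * r%:R - 1) * delta)) * asc_moment X r +
        r%:R * (gamma - mu - (r%:R - 1) * (beta + 1 - (r%:R - 1) * delta)) *
          asc_moment X r.-1] /\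
  (* (f) *)
  (forall r, (1 <= r <= 2 * n)%N ->
      (1 - r%:R * delta) * asc_moment X r.+1 =
        (mu + r%:R * (beta - r%:R * delta + 1)) * asc_moment X r +
        gamma * r`!%:R * (\sum_(k < r) asc_moment X k / k`!%:R) /\
      (1 - r%:R * delta) * desc_moment X r.+1 =
        (delta * r%:R ^+ 2 + beta * r%:R + mu) * desc_moment X r +
        (gamma - mu) * r`!%:R *
          (\sum_(k < r) (-1) ^+ (r + k + 1) * (desc_moment X k / k`!%:R))).
Proof.
move=> S q weight.
have X_int : integer_valued X by case: hX.
have pk := abs_moment_has_moment X_int hmom.
split; [|split; [|split; [|split]]].
- move=> i ni; have [P' [Y HY]] := rising_variable_exists hX hS hn hmom ni.
  by exists d, T, P', Y.
- move=> d' T' P' Y HY.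
  have pmfY i (ni : (i <= n)%N) : exists2 c, 0 < c &
      ipmf (Y i) = (fun j => c * rising_weight q (ipmf X) i j).
    have [Yint Yprop] := HY i ni.
    exact: (rising_variable_pmf hX hS hn hmom ni Yint Yprop).
  split.
  + have [c c0 hc] := pmfY 0%N (leq0n n).
    have [Yint _] := HY 0%N (leq0n n).
    have c1 : c = 1.
      rewrite -[LHS]mulr1; apply: isum_unique (isumZ c (isum_ipmf X_int)) _.
      apply: eq_isum (isum_ipmf Yint) => j.
      by rewrite hc rising_weight0.
    by move=> j; rewrite hc c1 mul1r rising_weight0.
  + move=> i /andP[i0 ni]; have i1n : (i.-1 < n)%N by rewrite prednK.
    have [c c0 hc] := pmfY i ni.
    have [c' c'0 hc'] := pmfY i.-1 (ltnW i1n).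
    have Di := rising_denom_gt0_lt hX hS hn hmom i1n.
    (* q_{i-1} p_{i-1} equals c' / D_{i-1} times w_i, while p_i is c times w_i. For i - 1 < n the
       denominator is positive unconditionally. *)
    exists (c * (1 - 2 * i.-1%:R * delta) / c') => j.
    rewrite hc hc' horner_q_ -(prednK i0) rising_weightS /= intrD.
    by field; rewrite !gt_eqF.
  + move=> i ni; have [Yint Yprop] := HY i ni.
    exact: (rising_variable_support hX hS hn hmom ni Yint Yprop).
  + move=> i ni Di; have [Yint Yprop] := HY i ni; split; last exact: coef_q_2.
    apply: (rising_variable_CO hX hS hn hmom ni Yint Yprop).
    exact: (rising_denom_neq0 hX hS hn hmom ni Di).
  + move=> i ni hpsi hi; have [Yint Yprop] := HY i ni.
    apply: (rising_variable_variance hX hS hn hmom ni Yint Yprop hpsi).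
    (* For i < n the order 2 i + 2 is below 2 n + 1; only i = n uses the extra moment. *)
    have [ein|nin] := eqVneq i n.
      by have := abs_moment_has_moment X_int (hi ein); rewrite ein.
    by apply: (CO_moment_le hX hmom); lia.
- move=> i ni hi.
  have H := isum_rising_weight_psi hX hS hn hmom ni hi.
  have si : (size (rising_poly q i) <= (2 * n + 1).+1)%N.
    by apply: leq_trans (size_rising_poly i (size_quad _ _ _)) _; lia.
  apply: (expectation_horner X_int si pk) => [t|]; first by rewrite rising_polyE.
  by apply: eq_isum H => j; rewrite rising_weight_poly.
- split.
  + rewrite /desc_moment (_ : (fun t => _) = cst 1) ?expectation_cst//.
    by apply/funext => t; rewrite /desc_fact big_ord0.
  + rewrite /asc_moment (_ : (fun t => _) = cst 1) ?expectation_cst//.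
    by apply/funext => t; rewrite /asc_fact big_ord0.
  + rewrite /desc_moment (_ : (fun t => _) = X).
      by case: hX => _ _ ->.
    by apply/funext => t; rewrite /desc_fact big_ord1 subr0.
  + rewrite /asc_moment (_ : (fun t => _) = X).
      by case: hX => _ _ ->.
    by apply/funext => t; rewrite /asc_fact big_ord1 addr0.
  + move=> [//|r] rn; have rk : (r.+1 < 2 * n + 1)%N by lia.
    split; first exact: (desc_moment_rec X_int pk hX rk).
    exact: (asc_moment_rec X_int pk hX rk).
- move=> [//|r] rn; have rk : (r.+1 < 2 * n + 1)%N by lia.
  split; first exact: (asc_moment_sum X_int pk hX rk).
  exact: (desc_moment_sum X_int pk hX rk).
Qed.
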